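(* There is no positive number $K$ such that $$\big\|[\varphi(A,B),R]\big\|\le K\,\|\varphi\|_{B^1_{\infty,1}(\mathbb R^2)}\max\big\{\|[A,R]\|,\,\|[B,R]\|\big\}$$ (operator norms) whenever $\varphi\in B^1_{\infty,1}(\mathbb R^2)$, $R$ is a bounded linear operator, and $A$ and $B$ are finite rank self-adjoint operators on Hilbert space (with $A$, $B$, $R$ acting on the same, arbitrary, Hilbert space).
   Context: $[X,Y]=XY-YX$. Homogeneous Besov class $B^1_{\infty,1}(\mathbb R^2)$. Let $w\ge0$ be a $C^\infty$ function on $(0,\infty)$ supported in $[1/2,2]$ with $w(s)=1-w(s/2)$ for $s\in[1,2]$, so that $\sum_{n\in\mathbb Z}w(2^{-n}s)=1$ for $s>0$. Let $W_n$ be the function on $\mathbb R^2$ with Fourier transform $w(2^{-n}\|\xi\|)$ and put $\varphi_n=\varphi*W_n$. Then $\varphi\in B^1_{\infty,1}(\mathbb R^2)$ if $\varphi$ is a tempered distribution with $\|\varphi\|_{B^1_{\infty,1}}:=\sum_{n\in\mathbb Z}2^n\|\varphi_n\|_{L^\infty}<\infty$ and $\nabla\varphi=\sum_{n\in\mathbb Z}\nabla\varphi_n$ (so $\varphi$ is determined by the $\varphi_n$ up to an additive constant; nonconstant polynomials are excluded). Such $\varphi$ are continuously differentiable functions. Functional calculus: $\varphi(A,B)=\iint\varphi(x,y)\,dE_A(x)\,dE_B(y)$, where $E_A,E_B$ are the spectral measures; for finite rank self-adjoint $A,B$ this is the finite sum $\sum_{\lambda\in\sigma(A)}\sum_{\mu\in\sigma(B)}\varphi(\lambda,\mu)E_A(\{\lambda\})E_B(\{\mu\})$.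 *)

(* Defs.v *)
From HB Require Import structures.
From mathcomp Require Import all_boot all_order all_algebra.
From mathcomp Require Import all_classical all_reals all_analysis.
From mathcomp Require Import complex.

Set Implicit Arguments.
Unset Strict Implicit.
Unset Printing Implicit Defensive.

Import Order.TTheory GRing.Theory Num.Theory.
Import numFieldNormedType.Exports.

Local Open Scope classical_set_scope.
Local Open Scope ring_scope.
Local Open Scope complex_scope.

Section complex_functions_on_the_plane.
Context {R : realType}.
Local Notation plane := (R * R)%type.
Implicit Types (f g : plane -> R[i]) (x y xi : plane).

(* [modulus z] is the [R]-valued modulus; [`|z|] lives in [R[i]]. *)
Local Notation modulus := Normc.normc.
Local Notation re := (@complex.Re R).
Local Notation im := (@complex.Im R).

Definition enorm x : R := Num.sqrt (x.1 ^+ 2 + x.2 ^+ 2).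

Definition dotp x y : R := x.1 * y.1 + x.2 * y.2.

Definition expi (t : R) : R[i] := cos t +i* sin t.

Definition plane_measure := (@lebesgue_measure R \x @lebesgue_measure R)%E.

Definition cintegrable f : Prop :=
  plane_measure.-integrable setT (fun x => (re (f x))%:E) /\
  plane_measure.-integrable setT (fun x => (im (f x))%:E).

Definition cintegral f : R[i] :=
  Rintegral plane_measure setT (re \o f) +i*
  Rintegral plane_measure setT (im \o f).

Definition ccontinuous f : Prop :=
  continuous (re \o f) /\ continuous (im \o f).

Definition basis_vector (i : bool) : plane := if i then (0, 1) else (1, 0).

Definition cderivable f : Prop := forall (i : bool) x,
  derivable (re \o f) x (basis_vector i) /\
  derivable (im \o f) x (basis_vector i).

Definition partial (i : bool) f : plane -> R[i] := fun x =>
  'D_(basis_vector i) (re \o f) x +i* 'D_(basis_vector i) (im \o f) x.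

Definition partials (s : seq bool) f : plane -> R[i] := foldr partial f s.

Definition smooth f : Prop :=
  forall s : seq bool, ccontinuous (partials s f) /\ cderivable (partials s f).

Definition schwartz_seminorm (N : nat) f : \bar R :=
  ereal_sup [set ((1 + enorm p.2) ^+ N * modulus (partials p.1 f p.2))%:E
            | p in [set p : seq bool * plane | (size p.1 <= N)%N]].

Definition schwartz f : Prop :=
  smooth f /\ forall N : nat, (schwartz_seminorm N f < +oo)%E.

(* [F f (xi) = \int f(x) e^{-i x.xi} dx]: with this normalization the Fourier
   transform of a convolution is the product of the Fourier transforms. *)
Definition fourier f : plane -> R[i] := fun xi =>
  cintegral (fun x => f x * expi (- dotp x xi)).

(* A tempered distribution is given by a total functional, of which only the
   values at Schwartz functions are meaningful. *)
Implicit Type T : (plane -> R[i]) -> R[i].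

Definition tempered T : Prop :=
  (forall (a : R[i]) f g, schwartz f -> schwartz g ->
     T (fun x => a * f x + g x) = a * T f + T g) /\
  exists (M : R) (N : nat), forall f, schwartz f ->
     ((modulus (T f))%:E <= M%:E * schwartz_seminorm N f)%E.

Definition regular_distr g : (plane -> R[i]) -> R[i] := fun f =>
  cintegral (fun x => g x * f x).

Definition distr_partial (i : bool) T : (plane -> R[i]) -> R[i] := fun f =>
  - T (partial i f).

Definition conv T g : plane -> R[i] := fun x => T (fun y => g (x - y)).

Definition besov_cutoff (w : R -> R) : Prop :=
  [/\ forall s, 0 <= w s,
      forall (n : nat) s, 0 < s -> derivable (derive1n n w) s 1,
      (* extended by [0] off the half-line, so that [w (2^-n * enorm 0) = 0] *)
      forall s, ~~ (2^-1 <= s <= 2) -> w s = 0 &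
      forall s, 1 <= s <= 2 -> w s = 1 - w (s / 2)].

Definition besov_kernels (w : R -> R) (W : int -> plane -> R[i]) : Prop :=
  forall n : int, schwartz (W n) /\
    forall xi, fourier (W n) xi = (w (2%:R ^ (- n) * enorm xi))%:C.

Definition besov_norm (W : int -> plane -> R[i]) T : \bar R :=
  (\esum_(n in [set: int]) ((2%:R ^ n)%:E *
     Lnorm plane_measure +oo (fun x => (modulus (conv T (W n) x))%:E)))%E.

(* The last clause is [grad T = \sum_(n in Z) grad (T * W_n)] in the sense of
   distributions; the series converges absolutely when the norm is finite, so
   the order of summation is immaterial. *)
Definition in_besov (W : int -> plane -> R[i]) T : Prop :=
  [/\ tempered T,
      (besov_norm W T < +oo)%E &
      forall (i : bool) f, schwartz f ->
        (fun N : nat => modulus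
          ((\sum_(k < N.*2.+1)
              distr_partial i (regular_distr (conv T (W (k%:Z - N%:Z)))) f)
           - distr_partial i T f)) @ \oo --> (0 : R)].

(* Every distribution in the class is a C^1 function, hence has a unique
   continuous representative, whose values enter the functional calculus. *)
Definition besov_function (W : int -> plane -> R[i]) (phi : plane -> R[i]) :
    Prop :=
  [/\ ccontinuous phi,
      forall f, schwartz f -> cintegrable (fun x => phi x * f x) &
      in_besov W (regular_distr phi)].

End complex_functions_on_the_plane.

Section operators.
Context {R : realType} {H : completeNormedModType R[i]}.
Implicit Types (dot : {dot H for (@Num.conj R[i])}) (A B : {linear H -> H}).

Definition hilbert_dot dot : Prop := forall x : H, `|x| ^+ 2 = dot x x.

Definition bounded_op A : Prop :=
  exists M : R, forall x : H, `|A x| <= M%:C * `|x|.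

Definition opnorm (F : H -> H) : \bar R :=
  ereal_sup [set (complex.Re `|F x|)%:E | x in [set x : H | `|x| <= 1]].

Definition commutator (X Y : H -> H) : H -> H := fun x => X (Y x) - Y (X x).

Definition selfadjoint dot A : Prop := forall x y : H, dot (A x) y = dot x (A y).

Definition finite_rank A : Prop :=
  exists (n : nat) (b : 'I_n -> H), forall x : H,
    exists c : 'I_n -> R[i], A x = \sum_(i < n) c i *: b i.

(* Only the real part of the spectrum, which is all of it when [A] is
   self-adjoint. *)
Definition spectrum A : set R :=
  [set l | ~ exists B, [/\ bounded_op B,
                           forall x, B (A x - l%:C *: x) = x &
                           forall x, A (B x) - l%:C *: B x = x]].

(* [E_A({l})]: the orthogonal projection onto [ker (A - l)]. *)
Definition spectral_proj dot A (l : R) : H -> H := fun x =>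
  xget 0 [set y : H | A y = l%:C *: y /\
            forall z : H, A z = l%:C *: z -> dot (x - y) z = 0].

(* The sums are over [spectrum A] and [spectrum B]; for operators of finite
   rank all but finitely many terms vanish. *)
Definition funcalc dot (phi : R * R -> R[i]) A B : H -> H := fun x =>
  \sum_(l \in spectrum A) \sum_(m \in spectrum B)
    phi (l, m) *: spectral_proj dot A l (spectral_proj dot B m x).

End operators.

(* Main.v *)
(* With omega = e^(2 pi i/n) and U = (omega^(jk) / sqrt n) the Fourier matrix,
   let A = diag(2 pi j) and let B be conjugate by U to diag(2 pi k). If
   phi(2 pi j, 2 pi k) = omega^(-jk) for all integers j, k, then the entries of
   phi(A, B) e_0 are all 1, so its norm is sqrt n, while phi(A, B + 2 pi) e_0
   has entries omega^(-j): the difference has norm sqrt (2n) although B is only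
   moved by 2 pi. On the direct sum of two copies, take A on both summands, B on
   the first and B + 2 pi on the second, and for Q the partial isometry mapping
   the second summand onto the first: the difference becomes the commutator
   with Q, while [A, Q] = 0 and [B, Q] = - 2 pi Q.
   A function phi with these values and a Besov norm bounded independently of n
   is obtained by Fejer interpolation at the nodes: the Fejer kernels form a
   partition of unity, so |phi| <= 1, and after a modulation all frequencies lie
   in the annulus 4 < |xi| < 8, where only two of the W_n act; hence the Besov
   norm is at most 4 |phi * W_2|_oo + 8 |phi * W_3|_oo, which is controlled by
   the L^1 norms of W_2 and W_3. *)
Require Import Defs.
From HB Require Import structures.
From mathcomp Require Import all_boot all_order all_algebra.
From mathcomp Require Import zify ring lra.
From mathcomp Require Import all_classical all_reals all_analysis.
From mathcomp Require Import complex measurable_realfun.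

Set Implicit Arguments.
Unset Strict Implicit.
Unset Printing Implicit Defensive.

Import Order.TTheory GRing.Theory Num.Theory.
Import numFieldNormedType.Exports.

Local Open Scope classical_set_scope.
Local Open Scope ring_scope.

(** * Integration on the plane *)

Section plane_integration.
Local Open Scope complex_scope.
Context {R : realType}.
Local Notation C := R[i].
Local Notation plane := (R * R)%type.
Local Notation mu := (@lebesgue_measure R).
Local Notation mu2 := (@plane_measure R).

Local Notation mplane :=
  ((measurableTypeR R * measurableTypeR R)%type : measurableType _).

(** Measurability refers to the product sigma-algebra, so an open set has to be written as a
    countable union of rectangles: squares with rational centre and radius. *)
Lemma open_plane_measurable (U : set plane) :
  open U -> measurable (U : set mplane).
Proof.
move=> oU.
pose B (a b r : rat) : set plane :=
  ball (ratr a : R) (ratr r : R) `*` ball (ratr b : R) (ratr r : R).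
have -> : U = \bigcup_(a : rat) \bigcup_(b : rat) \bigcup_(r : rat)
    (if `[< B a b r `<=` U >] then B a b r else set0).
  apply/seteqP; split=> [[x y] Uxy|xy [a _ [b _ [r _]]]]; last first.
    by case: asboolP => // BU /BU.
  have /nbhs_ballP[e /= e0 eU] : nbhs (x, y) U by exact: open_nbhs_nbhs.
  (* Points of a square of radius r differ by less than 2r in each coordinate, hence the bound
     [e / 2]. *)
  have [r] : exists r : rat, ratr r \in `]0, (e / 2)[.
    by apply: rat_in_itvoo; rewrite divr_gt0.
  rewrite in_itv /= => /andP[r0 re].
  have near_rat z : exists q : rat, ball (ratr q : R) (ratr r) z.
    have [q] : exists q : rat, ratr q \in `](z - ratr r), (z + ratr r)[.
      by apply: rat_in_itvoo; rewrite ltrBlDr -addrA ltrDl addr_gt0.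
    rewrite in_itv /= => /andP[q1 q2]; exists q.
    by rewrite /ball /= ltr_norml; apply/andP; split; lra.
  have [a xa] := near_rat x; have [b yb] := near_rat y.
  exists a => //; exists b => //; exists r => //; rewrite asboolT//.
  move=> [u v] [/= ua vb]; apply: eU; split => /=.
    move: xa ua; rewrite /ball /= !ltr_norml => /andP[? ?] /andP[? ?].
    by apply/andP; split; lra.
  move: yb vb; rewrite /ball /= !ltr_norml => /andP[? ?] /andP[? ?].
  by apply/andP; split; lra.
apply: bigcupT_measurable_rat => a; apply: bigcupT_measurable_rat => b.
apply: bigcupT_measurable_rat => r; case: ifP => // _.
by apply: measurableX; apply: open_measurable; exact: ball_open.
Qed.

Lemma continuous_plane_measurable (f : plane -> R) : continuous f ->
  measurable_fun [set: mplane] f.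
Proof.
move=> /continuousP cf; apply: (measurability _ (RGenOpens.measurableE R)).
move=> _ [_ [a [b ->] <-]]; rewrite setTI.
by apply: open_plane_measurable; apply: cf; exact: interval_open.
Qed.

Local Open Scope ereal_scope.

Lemma measurable_oneDsqrV :
  measurable_fun [set: measurableTypeR R] (fun x : R => (oneDsqr x)^-1)%R.
Proof. exact: continuous_measurable_fun (@continuous_oneDsqrV R). Qed.

(** The integral over the positive half-line is known; reflection in 0 carries it to the negative
    one. *)
Lemma integral_oneDsqrV_lty : \int[mu]_x ((oneDsqr x)^-1)%:E < +oo.
Proof.
have /measurable_EFinP mf := measurable_oneDsqrV.
have f0 (x : R) : 0 <= ((oneDsqr x)^-1)%:E by rewrite lee_fin invr_ge0.
have pos : \int[mu]_(x in `[0%R, +oo[) ((oneDsqr x)^-1)%:E < +oo.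
  by rewrite integral0y_oneDsqr ltry.
have neg : \int[mu]_(x in `]-oo, 0%R]) ((oneDsqr x)^-1)%:E < +oo.
  move: pos; rewrite ge0_integration_by_substitution0//.
  by under eq_integral do rewrite /oneDsqr sqrrN.
have -> : [set: measurableTypeR R] =
    `[0%R, +oo[%classic `|` `]-oo, 0%R[%classic.
  apply/esym; rewrite -subTset => x _ /=.
  by rewrite !in_itv /= andbT; case: (leP 0%R x) => ?; [left|right].
rewrite ge0_integral_setU//=; first 1 last.
- exact: measurable_funTS.
- apply/disj_setPS => x /=; rewrite !in_itv /= andbT => -[x0 x1].
  by move: (lt_le_trans x1 x0); rewrite ltxx.
apply: lte_add_pinfty => //; apply: le_lt_trans neg.
apply: ge0_subset_integral => //.
- exact: measurable_funTS.
- by move=> x /=; rewrite !in_itv /=; exact: ltW.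
Qed.

(** The common integrable majorant on the plane; being a product, it is integrated by Tonelli one
    variable at a time. *)
Definition decay (x : plane) : R := ((oneDsqr x.1)^-1 * (oneDsqr x.2)^-1)%R.

Lemma decay_ge0 x : (0 <= decay x)%R.
Proof. by rewrite mulr_ge0 ?invr_ge0. Qed.

Lemma decay_measurable : measurable_fun [set: mplane] decay.
Proof.
apply: measurable_funM.
  exact: (measurableT_comp measurable_oneDsqrV measurable_fst).
exact: (measurableT_comp measurable_oneDsqrV measurable_snd).
Qed.

Lemma decay_integrable : mu2.-integrable setT (EFin \o decay).
Proof.
apply/integrableP; split.
  by apply/measurable_EFinP; exact: decay_measurable.
have /measurable_EFinP mg := measurable_oneDsqrV.
have g0 (x : R) : 0 <= ((oneDsqr x)^-1)%:E by rewrite lee_fin invr_ge0.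
have I0 : 0 <= \int[mu]_y ((oneDsqr y)^-1)%:E by exact: integral_ge0.
have Ifin : \int[mu]_y ((oneDsqr y)^-1)%:E \is a fin_num.
  by rewrite ge0_fin_numE// integral_oneDsqrV_lty.
under eq_integral do rewrite /= ger0_norm ?decay_ge0//.
rewrite /plane_measure fubini_tonelli1//=; last 2 first.
- by apply/measurable_EFinP; exact: decay_measurable.
- by move=> x; rewrite lee_fin decay_ge0.
rewrite /fubini_F /decay /=.
under eq_integral => x _.
  under eq_integral do rewrite EFinM.
  rewrite ge0_integralZl//.
  over.
rewrite ge0_integralZr// -(fineK Ifin) -EFinM; exact: ltry.
Qed.

End plane_integration.

(** * Complex integrals on the plane and decay of Schwartz functions *)

Section complex_integration.
Local Open Scope complex_scope.
Context {R : realType}.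
Local Notation C := R[i].
Local Notation plane := (R * R)%type.
Local Notation mu := (@lebesgue_measure R).
Local Notation mu2 := (@plane_measure R).
Local Notation mplane :=
  ((measurableTypeR R * measurableTypeR R)%type : measurableType _).
Local Notation re := (@complex.Re R).
Local Notation im := (@complex.Im R).
Local Notation modulus := Normc.normc.
Implicit Types (f g : plane -> C).

Section reflection.
Local Open Scope ereal_scope.

Lemma measurable_reflection (a : R) :
  measurable_fun [set: measurableTypeR R]
    (fun y : measurableTypeR R => (a - y)%R : measurableTypeR R).
Proof.
apply: continuous_measurable_fun => y.
by apply: cvgB; [exact: cvg_cst|exact: cvg_id].
Qed.

(** Lebesgue measure is determined by its values on half-open intervals. *)
Lemma lebesgue_measure_reflection (a : R) (A : set (measurableTypeR R)) :
  measurable A ->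
  mu A = pushforward mu
    (fun y : measurableTypeR R => (a - y)%R : measurableTypeR R) A.
Proof.
move=> mA.
pose F : {mfun measurableTypeR R >-> measurableTypeR R} :=
  HB.pack (fun y : measurableTypeR R => (a - y)%R : measurableTypeR R)
    (isMeasurableFun.Build _ _ _ _ _ (measurable_reflection a)).
apply: (@lebesgue_measure_unique R (pushforward mu F)) => //= _ [[b c]] _ <- /=.
rewrite /pushforward /=.
(* Reflection moves the closed end to the other side, which leaves the length unchanged. *)
rewrite (_ : _ @^-1` _ = `[(a - c)%R, (a - b)%R[%classic); last first.
  apply/seteqP; split=> x /=; rewrite !in_itv /= => /andP[? ?];
  by apply/andP; split; lra.
rewrite !lebesgue_measure_itv /= !lte_fin ltrD2l ltrN2; case: ifP => // _.
by rewrite -!EFinB; congr _%:E; ring.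
Qed.

Lemma measurable_plane_reflection (a : plane) :
  measurable_fun [set: mplane] (fun y : mplane => a - y : mplane)%R.
Proof.
apply/measurable_fun_pairP; split => /=.
  exact: (measurableT_comp (measurable_reflection a.1) measurable_fst).
exact: (measurableT_comp (measurable_reflection a.2) measurable_snd).
Qed.

Definition plane_reflection (a : plane) : {mfun mplane >-> mplane} :=
  HB.pack (fun y : mplane => a - y : mplane)%R
    (isMeasurableFun.Build _ _ _ _ _ (measurable_plane_reflection a)).

(** A product measure is determined by rectangles, so it suffices to reflect each coordinate. The
    map y -> a - y is the change of variables in a convolution. *)
Lemma plane_measure_reflection (a : plane) (A : set mplane) : measurable A ->
  mu2 A = pushforward mu2 (plane_reflection a) A.
Proof.
apply: (@product_measure_unique _ _ _ _ R mu mu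
  (pushforward mu2 (plane_reflection a))).
move=> X Y mX mY; rewrite -[LHS]/(mu2 (plane_reflection a @^-1` (X `*` Y))).
rewrite (_ : _ @^-1` _ =
    ((fun y => a.1 - y)%R @^-1` X) `*` ((fun y => a.2 - y)%R @^-1` Y));
  last by apply/seteqP; split.
rewrite /plane_measure product_measure1E.
- by congr (_ * _); apply/esym; exact: lebesgue_measure_reflection.
- by rewrite -[X in measurable X]setTI; exact: measurable_reflection.
- by rewrite -[X in measurable X]setTI; exact: measurable_reflection.
Qed.

Lemma integrable_plane_reflection (a : plane) (g : mplane -> \bar R) :
  mu2.-integrable setT g -> mu2.-integrable setT (fun y => g (a - y)%R).
Proof.
move=> /integrableP[mg ig]; apply/integrableP; split.
  exact: (measurableT_comp mg (measurable_plane_reflection a)).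
apply: le_lt_trans ig.
rewrite [leRHS](eq_measure_integral (pushforward mu2 (plane_reflection a)));
  last by move=> A mA _; exact: plane_measure_reflection.
rewrite ge0_integral_pushforward//; exact: measurableT_comp.
Qed.

Lemma integral_plane_reflection (a : plane) (g : mplane -> \bar R) :
  mu2.-integrable setT g ->
  \int[mu2]_y g (a - y)%R = \int[mu2]_y g y.
Proof.
move=> ig; have /integrableP[mg _] := ig.
rewrite [RHS](eq_measure_integral (pushforward mu2 (plane_reflection a)));
  last by move=> A mA _; exact: plane_measure_reflection.
rewrite integral_pushforward//; exact: integrable_plane_reflection.
Qed.

End reflection.

Lemma cintegral_reflect (a : plane) f :
  cintegrable f -> cintegral (fun y => f (a - y)) = cintegral f.
Proof.
move=> [rf imf]; rewrite /cintegral /Rintegral /=.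
rewrite (@integral_plane_reflection a (fun x => (re (f x))%:E))//.
by rewrite (@integral_plane_reflection a (fun x => (im (f x))%:E)).
Qed.

Lemma eq_cintegral f g : f =1 g -> cintegral f = cintegral g.
Proof. by move=> /funext ->. Qed.

Lemma cintegrableD f g : cintegrable f -> cintegrable g ->
  cintegrable (fun x => f x + g x).
Proof.
move=> [rf imf] [rg img]; split.
  rewrite (_ : (fun x => _) = (fun x => (re (f x))%:E + (re (g x))%:E)%E).
    exact: integrableD.
  by apply/funext => x; rewrite -EFinD; case: (f x) (g x) => ? ? [].
rewrite (_ : (fun x => _) = (fun x => (im (f x))%:E + (im (g x))%:E)%E).
  exact: integrableD.
by apply/funext => x; rewrite -EFinD; case: (f x) (g x) => ? ? [].
Qed.

Lemma cintegralD f g : cintegrable f -> cintegrable g ->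
  cintegral (fun x => f x + g x) = cintegral f + cintegral g.
Proof.
move=> [rf imf] [rg img]; rewrite /cintegral.
have -> : re \o (fun x => f x + g x) = fun x => (re (f x) + re (g x)).
  by apply/funext => x /=; case: (f x) (g x) => ? ? [].
have -> : im \o (fun x => f x + g x) = fun x => (im (f x) + im (g x)).
  by apply/funext => x /=; case: (f x) (g x) => ? ? [].
by rewrite !RintegralD.
Qed.

Lemma cintegrableZ (c : C) f : cintegrable f -> cintegrable (fun x => c * f x).
Proof.
case: c => u v [rf imf]; split.
  rewrite (_ : (fun x => _) =
    (fun x => u%:E * (re (f x))%:E + (- v)%:E * (im (f x))%:E)%E).
    by apply: integrableD => //; exact: integrableZl.
  apply/funext => x; rewrite -!EFinM -EFinD; congr _%:E.
  by case: (f x) => ? ? /=; rewrite mulNr.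
rewrite (_ : (fun x => _) =
  (fun x => u%:E * (im (f x))%:E + v%:E * (re (f x))%:E)%E).
  by apply: integrableD => //; exact: integrableZl.
by apply/funext => x; rewrite -!EFinM -EFinD; case: (f x) => ? ? /=.
Qed.

Lemma cintegralZ (c : C) f : cintegrable f ->
  cintegral (fun x => c * f x) = c * cintegral f.
Proof.
case: c => u v [rf imf]; rewrite /cintegral.
have Zl (r : R) (h : plane -> R) : mu2.-integrable setT (fun x => (h x)%:E) ->
    mu2.-integrable setT (fun x => (r * h x)%:E).
  by move=> ih; under eq_fun do rewrite EFinM; exact: integrableZl.
have -> : re \o (fun x => (u +i* v) * f x) =
    fun x => u * re (f x) + (- v) * im (f x).
  by apply/funext => x /=; case: (f x) => ? ? /=; rewrite mulNr.
have -> : im \o (fun x => (u +i* v) * f x) =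
    fun x => u * im (f x) + v * re (f x).
  by apply/funext => x /=; case: (f x) => ? ? /=.
rewrite !RintegralD//; try exact: Zl.
rewrite !RintegralZl//.
by apply/eqP; rewrite eq_complex /= mulNr !eqxx.
Qed.

Lemma cintegrable0 : cintegrable (fun=> 0 : C).
Proof. by split; exact: integrable0. Qed.

Lemma cintegral0 : cintegral (fun=> 0 : C) = 0.
Proof.
rewrite /cintegral.
have -> : re \o (fun=> 0) = cst 0 :> (plane -> R) by [].
have -> : im \o (fun=> 0) = cst 0 :> (plane -> R) by [].
by rewrite /Rintegral integral0.
Qed.

Lemma cintegrable_sum (I : Type) (s : seq I) (F : I -> plane -> C) :
  (forall i, cintegrable (F i)) -> cintegrable (fun x => \sum_(i <- s) F i x).
Proof.
move=> iF; elim: s => [|i s IH].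
  by under eq_fun do rewrite big_nil; exact: cintegrable0.
by under eq_fun do rewrite big_cons; exact: cintegrableD.
Qed.

Lemma cintegral_sum (I : Type) (s : seq I) (F : I -> plane -> C) :
  (forall i, cintegrable (F i)) ->
  cintegral (fun x => \sum_(i <- s) F i x) = \sum_(i <- s) cintegral (F i).
Proof.
move=> iF; elim: s => [|i s IH].
  by under eq_fun do rewrite big_nil; rewrite cintegral0 big_nil.
under eq_fun do rewrite big_cons.
by rewrite cintegralD ?IH ?big_cons//; exact: cintegrable_sum.
Qed.

Lemma re_le_modulus (z : C) : `|re z| <= modulus z.
Proof. by have := normc_ge_Re z; rewrite lecR. Qed.

Lemma im_le_modulus (z : C) : `|im z| <= modulus z.
Proof. by case: z => a b /=; rewrite -sqrtr_sqr ler_wsqrtr// lerDr sqr_ge0. Qed.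

Lemma modulus_le_re_im (z : C) : modulus z <= `|re z| + `|im z|.
Proof.
case: z => a b /=.
rewrite -(ler_pXn2r (n := 2))// ?nnegrE ?sqrtr_ge0 ?addr_ge0//.
rewrite sqr_sqrtr ?addr_ge0 ?sqr_ge0// sqrrD !real_normK ?num_real//.
by rewrite -addrA lerD2l lerDr mulrn_wge0// mulr_ge0.
Qed.

(** Real and imaginary parts are each dominated by [M * decay]; adding the two bounds gives the
    factor 2. *)
Lemma ccontinuous_decay_integrable f (M : R) : ccontinuous f ->
  (forall x, modulus (f x) <= M * decay x) ->
  cintegrable f /\ modulus (cintegral f) <= M * Rintegral mu2 setT decay *+ 2.
Proof.
move=> [cr ci] fM.
have iM : mu2.-integrable setT (EFin \o (fun x => M * decay x)).
  have -> : EFin \o (fun x : mplane => M * decay x) =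
      (fun x => M%:E * (EFin \o decay) x)%E.
    by apply/funext => x /=; rewrite EFinM.
  by apply: integrableZl => //; exact: decay_integrable.
have part_int (h : plane -> R) :
    continuous h -> (forall x, `|h x| <= M * decay x) ->
    mu2.-integrable setT (EFin \o h) /\
    `|Rintegral mu2 setT h| <= M * Rintegral mu2 setT decay.
  move=> ch hM; have ih : mu2.-integrable setT (EFin \o h).
    apply: le_integrable iM => //.
      by apply/measurable_EFinP; exact: continuous_plane_measurable.
    move=> x _ /=; rewrite lee_fin.
    by apply: le_trans (ler_norm _); exact: hM.
  split => //; apply: (le_trans (le_normr_Rintegral _ _)) => //.
  rewrite -RintegralZl//; last exact: decay_integrable.
  apply: le_Rintegral => //.
  have -> : EFin \o (fun x : mplane => `|h x|) = (abse \o (EFin \o h)) by [].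
  exact: integrable_abse.
have [ir br] := part_int (re \o f) cr
  (fun x => le_trans (re_le_modulus _) (fM x)).
have [ii bi] := part_int (im \o f) ci
  (fun x => le_trans (im_le_modulus _) (fM x)).
split; first by split.
by apply: (le_trans (modulus_le_re_im _)); rewrite mulr2n lerD.
Qed.

Lemma ccontinuousM f g : ccontinuous f -> ccontinuous g ->
  ccontinuous (fun x => f x * g x).
Proof.
move=> [rf imf] [rg img]; split.
  rewrite (_ : _ \o _ = fun x => re (f x) * re (g x) - im (f x) * im (g x)).
    move=> x; apply: cvgB.
      by apply: cvgM; [exact: rf|exact: rg].
    by apply: cvgM; [exact: imf|exact: img].
  by apply/funext => x /=; case: (f x) (g x) => ? ? [].
rewrite (_ : _ \o _ = fun x => re (f x) * im (g x) + im (f x) * re (g x)).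
  move=> x; apply: cvgD.
    by apply: cvgM; [exact: rf|exact: img].
  by apply: cvgM; [exact: imf|exact: rg].
by apply/funext => x /=; case: (f x) (g x) => ? ? [].
Qed.

Lemma ccontinuousD f g : ccontinuous f -> ccontinuous g ->
  ccontinuous (fun x => f x + g x).
Proof.
move=> [rf imf] [rg img]; split.
  rewrite (_ : _ \o _ = fun x => re (f x) + re (g x)).
    by move=> x; apply: cvgD; [exact: rf|exact: rg].
  by apply/funext => x /=; case: (f x) (g x) => ? ? [].
rewrite (_ : _ \o _ = fun x => im (f x) + im (g x)).
  by move=> x; apply: cvgD; [exact: imf|exact: img].
by apply/funext => x /=; case: (f x) (g x) => ? ? [].
Qed.

Lemma ccontinuous_cst (c : C) : ccontinuous (fun _ : plane => c).
Proof. by split => x; exact: cst_continuous. Qed.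

Lemma ccontinuous_sum (I : Type) (s : seq I) (F : I -> plane -> C) :
  (forall i, ccontinuous (F i)) -> ccontinuous (fun x => \sum_(i <- s) F i x).
Proof.
move=> cF; elim: s => [|i s IH].
  by under eq_fun do rewrite big_nil; exact: ccontinuous_cst.
by under eq_fun do rewrite big_cons; exact: ccontinuousD.
Qed.

Lemma ccontinuous_expi (h : plane -> R) : continuous h ->
  ccontinuous (fun x => expi (h x)).
Proof.
move=> ch; split => x.
  by apply: (@continuous_comp _ _ _ h (@cos R)) (ch x) _; exact: continuous_cos.
by apply: (@continuous_comp _ _ _ h (@sin R)) (ch x) _; exact: continuous_sin.
Qed.

Lemma ccontinuous_comp f (h : plane -> plane) : ccontinuous f -> continuous h ->
  ccontinuous (f \o h).
Proof.
move=> [rf imf] ch; split => x.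
  by apply: (@continuous_comp _ _ _ h (re \o f)); [exact: ch|exact: rf].
by apply: (@continuous_comp _ _ _ h (im \o f)); [exact: ch|exact: imf].
Qed.

(** Each factor 1 + x_i^2 is at most (1 + |x|)^2. This is why the Schwartz seminorm of order 4 is
    the one used throughout. *)
Lemma decayV_le (x : plane) : (decay x)^-1 <= (1 + enorm x) ^+ 4.
Proof.
rewrite /decay -invfM invrK /oneDsqr.
have e0 : 0 <= enorm x by exact: sqrtr_ge0.
have e2 : enorm x ^+ 2 = x.1 ^+ 2 + x.2 ^+ 2.
  by rewrite sqr_sqrtr// addr_ge0 ?sqr_ge0.
rewrite (_ : 4%N = (2 + 2)%N)// exprD ler_pM ?addr_ge0 ?sqr_ge0//.
  rewrite sqrrD expr1n e2 mul1r -addrA lerD2l addrCA lerDl.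
  by rewrite addr_ge0 ?sqr_ge0// mulrn_wge0.
rewrite sqrrD expr1n e2 mul1r -addrA lerD2l addrA lerDr.
by rewrite addr_ge0 ?sqr_ge0// mulrn_wge0.
Qed.

Lemma schwartz_decay f (s : seq bool) : (size s <= 4)%N -> schwartz f ->
  forall x, modulus (partials s f x) <= fine (schwartz_seminorm 4 f) * decay x.
Proof.
move=> s4 [_ /(_ 4%N) fin] x.
have le_sn : (((1 + enorm x) ^+ 4 * modulus (partials s f x))%:E <=
    schwartz_seminorm 4 f)%E.
  by apply: ereal_sup_ubound; exists (s, x).
have m0 : 0 <= modulus (partials s f x) by exact: le_trans (re_le_modulus _).
(* The seminorm dominates a nonnegative value, so together with its upper bound it is finite and
   [fine] loses nothing. *)
have sn_fin : schwartz_seminorm 4 f \is a fin_num.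
  rewrite ge0_fin_numE//; apply: le_trans le_sn.
  by rewrite lee_fin mulr_ge0// exprn_ge0// addr_ge0// sqrtr_ge0.
rewrite -(fineK sn_fin) lee_fin in le_sn.
have d0 : 0 < decay x by rewrite mulr_gt0// invr_gt0 (lt_le_trans ltr01).
rewrite -ler_pdivrMr// mulrC; apply: le_trans le_sn.
by rewrite ler_wpM2r// decayV_le.
Qed.

Lemma schwartz_partial_ccontinuous f s :
  schwartz f -> ccontinuous (partials s f).
Proof. by move=> [/(_ s)[]]. Qed.

End complex_integration.

(** * A finite-dimensional Hilbert space *)

(** An alias of the row vectors, so that the Euclidean norm rather than the sup norm of matrices is
    attached to it. *)
Definition euclidean (R : realType) (n : nat) : Type := 'rV[R[i]]_n.

Section euclidean_space.
Local Open Scope complex_scope.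
Variables (R : realType) (n : nat).
Local Notation C := R[i].
Local Notation E := (euclidean R n).

HB.instance Definition _ := GRing.Lmodule.copy E 'rV[C]_n.

Definition edot (x y : E) : C := @dotmx C n x y.

Lemma edotE (x y : E) : edot x y = \sum_i x 0 i * Num.conj (y 0 i).
Proof. by rewrite /edot dotmxE mxE; apply: eq_bigr => i _; rewrite !mxE. Qed.

Fact edot_bilinear : bilinear_for *%R (@Num.conj C \; *%R) edot.
Proof.
split=> u a x y /=; rewrite !edotE mulr_sumr -big_split;
  apply: eq_bigr => i _ /=.
  by rewrite !mxE mulrDl mulrA.
by rewrite !mxE rmorphD rmorphM mulrDr mulrCA.
Qed.

HB.instance Definition _ :=
  bilinear_isBilinear.Build C E E C *%R (@Num.conj C \; *%R) edot edot_bilinear.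

Fact edot_hermitian (x y : E) :
  edot x y = (-1) ^+ false * Num.conj (edot y x).
Proof.
rewrite mul1r !edotE rmorph_sum; apply: eq_bigr => i _.
by rewrite rmorphM /= conjCK mulrC.
Qed.

HB.instance Definition _ :=
  isHermitianSesquilinear.Build C E false (@Num.conj C) edot edot_hermitian.

Fact edot_gt0 (x : E) : x != 0 -> 0 < edot x x.
Proof. exact: (@dotmx_is_dotmx C n x). Qed.

HB.instance Definition _ := isDotProduct.Build C E edot edot_gt0.

Definition euclidean_norm (x : E) : C := sqrtC (edot x x).

Fact euclidean_normD x y :
  euclidean_norm (x + y) <= euclidean_norm x + euclidean_norm y.
Proof. exact: (triangle_lerif (@dotmx C n) x y). Qed.

Fact euclidean_normZ (a : C) x :
  euclidean_norm (a *: x) = `|a| * euclidean_norm x.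
Proof.
by rewrite /euclidean_norm (dnormZ edot) sqrtCM ?nnegrE ?exprn_ge0 ?dnorm_ge0//
           sqrCK.
Qed.

Fact euclidean_norm_eq0 x : euclidean_norm x = 0 -> x = 0.
Proof. by move/eqP; rewrite sqrtC_eq0 (dnorm_eq0 edot) => /eqP. Qed.

HB.instance Definition _ :=
  Lmodule_isNormed.Build C E euclidean_normD euclidean_normZ euclidean_norm_eq0.

Lemma norm_edot (x : E) : `|x| ^+ 2 = edot x x.
Proof. by rewrite sqrtCK. Qed.

Lemma norm_coord_le (x : E) i : `|x 0 i| <= `|x|.
Proof.
rewrite -ler_sqr ?nnegrE// norm_edot edotE (bigD1 i)//= -normCK lerDl.
by apply: sumr_ge0 => j _; rewrite mul_conjC_ge0.
Qed.

Lemma norm_le_sum_coord (x : E) : `|x| <= \sum_i `|x 0 i|.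
Proof.
rewrite -ler_sqr ?nnegrE ?sumr_ge0// norm_edot edotE expr2 mulr_suml.
apply: ler_sum => i _; rewrite -normCK expr2 ler_wpM2l// (bigD1 i)//= lerDl.
exact: sumr_ge0.
Qed.

Lemma norm_le_ReIm (z : C) : `|z| <= (`|complex.Re z| + `|complex.Im z|)%:C.
Proof.
rewrite [in leLHS](complexE z) (le_trans (ler_normD _ _))//.
rewrite normrM !normc_def /= !expr0n !expr1n /= !addr0 add0r.
by rewrite sqrtr1 !sqrtr_sqr mul1r rmorphD.
Qed.

(** A 1-Lipschitz map sends a Cauchy filter to a Cauchy filter, and the reals are complete. It is
    applied to the real and imaginary parts of the coordinates. *)
Lemma lipschitz_cauchy_cvg (f : E -> R) (F : set_system E) :
  (forall x y, (`|f x - f y|)%:C <= `|x - y|) ->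
  ProperFilter F -> cauchy F -> exists l : R, f @ F --> l.
Proof.
move=> lipf FF /cauchy_ballP Fc; apply/cvg_ex; apply: R_complete.
apply/cauchy_ballP => e e0.
have e0C : 0 < e%:C by rewrite ltcR.
have [[A B] /= [FA FB] AB] := Fc _ e0C.
exists (f @` A, f @` B) => /=.
  by split; [apply: filterS FA|apply: filterS FB] => x ?; exists x.
move=> [_ _] /= [[x Ax <-] [y By <-]].
have := AB (x, y) (conj Ax By); rewrite -!ball_normE /= => xy.
by rewrite -ltcR; apply: le_lt_trans xy.
Qed.

Fact euclidean_complete (F : set_system E) :
  ProperFilter F -> cauchy F -> cvg F.
Proof.
move=> FF Fc.
have re_cvg i : exists l : R, (fun x : E => complex.Re (x 0 i)) @ F --> l.
  apply: lipschitz_cauchy_cvg => // x y.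
  apply: le_trans (norm_coord_le _ i); rewrite !mxE -raddfB.
  exact: normc_ge_Re.
have im_cvg i : exists l : R, (fun x : E => complex.Im (x 0 i)) @ F --> l.
  apply: lipschitz_cauchy_cvg => // x y.
  apply: le_trans (norm_coord_le _ i); rewrite !mxE -raddfB normc_def lecR.
  by rewrite -sqrtr_sqr ler_wsqrtr// lerDr sqr_ge0.
have [a ha] := choice re_cvg; have [b hb] := choice im_cvg.
apply/cvg_ex; exists (\row_i (a i +i* b i) : E).
apply/cvgrPdist_le => e; rewrite ltcE => /andP[/eqP ime re0].
(* Each of the n coordinates contributes at most 2d, one d for each of its two parts; [n.+1] covers
   the case n = 0. *)
pose d := complex.Re e / (2 * n.+1)%:R.
have d0 : 0 < d by rewrite divr_gt0// ltr0n.
have hre : \forall x \near F, forall i, `|a i - complex.Re ((x : E) 0 i)| <= d.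
  by apply: filter_forall => i; exact: (cvgr_dist_le _ _ (ha i) _ d0).
have him : \forall x \near F, forall i, `|b i - complex.Im ((x : E) 0 i)| <= d.
  by apply: filter_forall => i; exact: (cvgr_dist_le _ _ (hb i) _ d0).
apply: filterS2 hre him => x hre him.
apply: (le_trans (norm_le_sum_coord _)).
apply: (@le_trans _ _ (\sum_(i < n) (d *+ 2)%:C)).
  apply: ler_sum => i _; apply: (le_trans (norm_le_ReIm _)); rewrite lecR.
  move: (hre i) (him i); rewrite !mxE mulr2n.
  by case: (x 0 i) => u v; exact: lerD.
have de : d *+ 2 *+ n.+1 = complex.Re e.
  by rewrite -mulrnA -mulr_natr divfK// pnatr_eq0.
rewrite sumr_const card_ord -rmorphMn lecE /= ime eqxx /= -de.
by rewrite ler_wpMn2l// mulrn_wge0// ltW.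
Qed.

HB.instance Definition _ := Uniform_isComplete.Build E euclidean_complete.

End euclidean_space.

(** Everything about operators below uses only such a basis, never the coordinates of row
    vectors. *)
Lemma exists_hilbert_basis (R : realType) (I : finType) :
  exists (H : completeNormedModType R[i]) (dot : {dot H for (@Num.conj R[i])})
    (e : I -> H),
  [/\ hilbert_dot dot, forall i j, dot (e i) (e j) = (i == j)%:R &
      forall x, x = \sum_i dot x (e i) *: e i].
Proof.
pose n := #|I|.
exists (euclidean R n : completeNormedModType _).
exists (@edot R n : {dot (euclidean R n) for (@Num.conj R[i])}).
exists (fun i => (delta_mx 0 (enum_rank i) : 'rV[R[i]]_n)); split.
- exact: norm_edot.
- move=> i j.
  rewrite [LHS]edotE (bigD1 (enum_rank i))//= big1 => [|k /negbTE ki].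
    by rewrite !mxE !eqxx mul1r addr0 /= (inj_eq enum_rank_inj) conjC_nat.
  by rewrite !mxE ki andbF mul0r.
- move=> x; rewrite [LHS](row_sum_delta (x : 'rV[R[i]]_n)).
  rewrite (reindex _ (onW_bij _ (enum_rank_bij I))) /=.
  apply: eq_bigr => i _; congr (_ *: _).
  rewrite [RHS]edotE (bigD1 (enum_rank i))//= big1 => [|k /negbTE ki].
    by rewrite !mxE !eqxx conjC1 mulr1 addr0.
  by rewrite !mxE ki andbF conjC0 mulr0.
Qed.

(** * Roots of unity *)

Section roots_of_unity.
Variable R : realType.
Local Notation C := R[i].
Implicit Types (x y : R) (n : nat).

Lemma expiD x y : expi (x + y) = expi x * expi y.
Proof. by rewrite /expi cosD sinD; simpc; rewrite (addrC (sin x * _)). Qed.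

Lemma expi0 : expi (0 : R) = 1.
Proof. by rewrite /expi cos0 sin0. Qed.

Lemma expi_conj x : Num.conj (expi x) = expi (- x).
Proof. by rewrite /expi cosN sinN. Qed.

Lemma expi_unit x : expi x * expi (- x) = 1.
Proof. by rewrite -expiD subrr expi0. Qed.

Lemma norm_expi x : `|expi x| = 1.
Proof.
apply/eqP; rewrite -(@pexpr_eq1 _ _ 2)// normCK expi_conj.
by rewrite expi_unit.
Qed.

Lemma expiXn x n : expi x ^+ n = expi (x *+ n).
Proof.
elim: n => [|n IH]; first by rewrite expr0 mulr0n expi0.
by rewrite exprS mulrS IH expiD.
Qed.

Lemma expi_2piMn n : expi (2 * pi *+ n : R) = 1.
Proof.
by rewrite -expiXn /expi mulr_natl cos2pi sin2pi expr1n.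
Qed.

(** The real part is 1 - 2 sin^2(x/2), and the sine is positive on (0, pi). *)
Lemma expi_neq1 x : 0 < x < 2 * pi -> expi x != 1.
Proof.
move=> /andP[x0 xpi]; rewrite eq_complex negb_and /=.
have s0 : 0 < sin (x / 2).
  by apply: sin_gt0_pi; rewrite divr_gt0//= ltr_pdivrMr// mulrC.
have -> : cos x = 1 - sin (x / 2) ^+ 2 *+ 2.
  by rewrite {1}(splitr x) -mulr2n cos_mulr2n cos2sin2; ring.
by rewrite lt_eqF// ltrBlDr ltrDl pmulrn_lgt0// exprn_gt0.
Qed.

Definition zeta n : C := expi (2 * pi / n%:R).

Lemma zeta_prim n : (0 < n)%N -> n.-primitive_root (zeta n).
Proof.
move=> n0; rewrite /primitive_root_of_unity n0 /=; apply/forallP => i.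
rewrite unity_rootE /zeta expiXn -[_ / _ *+ _]mulr_natr.
have nR : 0 < n%:R :> R by rewrite ltr0n.
have [->|in1] := eqVneq i.+1 n.
  by rewrite divfK ?lt0r_neq0// [expi _](expi_2piMn 1) eqxx.
have lt_in : (i.+1 < n)%N by rewrite ltn_neqAle in1 ltn_ord.
rewrite (negbTE (expi_neq1 _))// mulrAC.
rewrite divr_gt0 ?mulr_gt0 ?pi_gt0 ?ltr0n//=.
by rewrite ltr_pdivrMr// ltr_pM2l ?mulr_gt0 ?pi_gt0// ltr_nat.
Qed.

Lemma zeta_conj n : Num.conj (zeta n) = (zeta n)^-1.
Proof.
by rewrite /zeta expi_conj -[RHS]mulr1 -(expi_unit (2 * pi / n%:R))
  mulKf// -normr_gt0 norm_expi.
Qed.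

Lemma norm_zeta n : `|zeta n| = 1.
Proof. exact: norm_expi. Qed.

(** A geometric sum with ratio q = zeta^(i - j): if q is not 1, then multiplying by q - 1 gives q^n
    - 1 = 0. The indices are arbitrary naturals because the Fejer kernels are evaluated at all
    nodes. *)
Lemma zeta_orthogonality n i j : (0 < n)%N ->
  \sum_(l < n) zeta n ^+ (i * l) * Num.conj (zeta n ^+ (j * l)) =
  (i == j %[mod n])%:R * n%:R.
Proof.
move=> n0; have zP := zeta_prim n0.
have z0 : zeta n != 0 by rewrite -normr_gt0 norm_zeta.
pose q := zeta n ^+ i / zeta n ^+ j.
have -> : \sum_(l < n) zeta n ^+ (i * l) * Num.conj (zeta n ^+ (j * l)) =
    \sum_(l < n) q ^+ l.
  apply: eq_bigr => l _.
  by rewrite rmorphXn /= zeta_conj !exprM exprVn exprMn exprVn.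
have [ij|ij] := eqVneq (i %% n)%N (j %% n)%N.
  have q1 : q = 1.
    rewrite /q; have /eqP -> : zeta n ^+ i == zeta n ^+ j.
      by rewrite (eq_prim_root_expr zP) ij.
    by rewrite divff// expf_neq0.
  under eq_bigr do rewrite q1 expr1n.
  by rewrite sumr_const card_ord mul1r.
have q1 : q != 1.
  apply: contra ij => /eqP /divr1_eq ij.
  by rewrite -(eq_prim_root_expr zP) ij.
apply: (mulfI (_ : q - 1 != 0)); first by rewrite subr_eq0.
rewrite -subrX1 /q exprMn exprVn -!exprM !(mulnC _ n) !exprM.
by rewrite (prim_expr_order zP) !expr1n invr1 mulr1 subrr mul0r mulr0.
Qed.

Lemma zeta_orthogonality_ord n (i j : 'I_n) :
  \sum_(l < n) zeta n ^+ (i * l) * Num.conj (zeta n ^+ (j * l)) =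
  (i == j)%:R * n%:R.
Proof.
by rewrite zeta_orthogonality ?(leq_ltn_trans _ (ltn_ord i))// !modn_small.
Qed.

End roots_of_unity.

(** * Operators diagonal in an orthonormal basis *)

Section diagonal_operators.
Local Open Scope complex_scope.
Context {R : realType} {H : completeNormedModType R[i]}.
Context {dot : {dot H for (@Num.conj R[i])}}.
Local Notation C := R[i].
Hypothesis hd : hilbert_dot dot.

Definition orthonormal_basis (I : finType) (e : I -> H) :=
  (forall i j, dot (e i) (e j) = (i == j)%:R) /\
  (forall x, x = \sum_i dot x (e i) *: e i).

Section operator.
Variables (I : finType) (e f : I -> H) (c : I -> C).

(** Sends [e i] to [c i *: f i] when [e] is orthonormal. It covers both diagonal operators ([f = e])
    and the partial isometry between the summands. *)
Definition weighted_map (x : H) : H := \sum_i (c i * dot x (e i)) *: f i.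

Fact weighted_map_linear : linear weighted_map.
Proof.
move=> a x y; rewrite /weighted_map scaler_sumr -big_split /=.
apply: eq_bigr => i _; rewrite linearPl /= mulrDr scalerDl scalerA.
by rewrite mulrCA.
Qed.

HB.instance Definition _ :=
  GRing.isLinear.Build C H H *:%R weighted_map weighted_map_linear.

Lemma weighted_map_finite_rank : finite_rank weighted_map.
Proof.
exists #|I|, (fun i => f (enum_val i)) => x.
exists (fun i => c (enum_val i) * dot x (e (enum_val i))).
exact: (reindex _ (onW_bij _ (enum_val_bij I))).
Qed.

End operator.

Section basis.
Variables (I : finType) (e : I -> H).
Hypothesis be : orthonormal_basis e.

Lemma dot_sum_basis (c : I -> C) j : dot (\sum_i c i *: e i) (e j) = c j.
Proof.
rewrite linear_sumlz /= (bigD1 j)//= big1 => [|i ij].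
  by rewrite linearZl_LR /= be.1 eqxx mulr1 addr0.
by rewrite linearZl_LR /= be.1 (negbTE ij) mulr0.
Qed.

Lemma norm_sum_basis (c : I -> C) :
  `|\sum_i c i *: e i| ^+ 2 = \sum_i `|c i| ^+ 2.
Proof.
rewrite hd linear_sumr /=; apply: eq_bigr => i _.
by rewrite linearZr_LR /= dot_sum_basis mulrC -normCK.
Qed.

Lemma parseval x : `|x| ^+ 2 = \sum_i `|dot x (e i)| ^+ 2.
Proof. by rewrite [in LHS](be.2 x) norm_sum_basis. Qed.

Lemma norm_dot_basis x i : `|dot x (e i)| <= `|x|.
Proof.
rewrite -ler_sqr ?nnegrE// parseval (bigD1 i)//= lerDl.
by apply: sumr_ge0 => j _; exact: exprn_ge0.
Qed.

Lemma weighted_map_bounded (f : I -> H) c : bounded_op (weighted_map e f c).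
Proof.
pose M := \sum_i `|c i| * `|f i|.
have M0 : 0 <= M by apply: sumr_ge0 => i _; exact: mulr_ge0.
exists (complex.Re M) => x; rewrite RRe_real ?ger0_real//.
rewrite /M mulr_suml (le_trans (ler_norm_sum _ _ _))// ler_sum// => i _.
by rewrite normrZ normrM mulrAC ler_wpM2l// ?mulr_ge0// norm_dot_basis.
Qed.

Lemma weighted_map_basis (f : I -> H) c i :
  weighted_map e f c (e i) = c i *: f i.
Proof.
rewrite /weighted_map (bigD1 i)//= big1 => [|j ji].
  by rewrite be.1 eqxx mulr1 addr0.
by rewrite be.1 eq_sym (negbTE ji) mulr0 scale0r.
Qed.

Lemma linear_basis_ext (T S : {linear H -> H}) :
  (forall i, T (e i) = S (e i)) -> T =1 S.
Proof.
move=> TS x; rewrite (be.2 x) !linear_sum; apply: eq_bigr => i _.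
by rewrite !linearZ /= TS.
Qed.

Variable l : I -> R.
Local Notation A := (weighted_map e e (fun i => (l i)%:C)).

Lemma dot_diagonal x i : dot (A x) (e i) = (l i)%:C * dot x (e i).
Proof. by rewrite dot_sum_basis. Qed.

Lemma diagonal_selfadjoint : selfadjoint dot A.
Proof.
move=> x y; rewrite linear_sumlz linear_sumr /=; apply: eq_bigr => i _.
rewrite linearZl_LR linearZr_LR /= rmorphM /=.
have -> : Num.conj (l i)%:C = (l i)%:C by exact: conjc_real.
by rewrite (hermC _ (e i)) expr0 mul1r mulrAC.
Qed.

Lemma diagonal_eigenvector (r : R) x :
  A x = r%:C *: x <-> forall i, l i != r -> dot x (e i) = 0.
Proof.
split=> [Ax i lir|xr].
  have := dot_diagonal x i; rewrite Ax linearZl_LR /= => /eqP.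
  rewrite -subr_eq0 -mulrBl mulf_eq0 => /orP[|/eqP//].
  rewrite -rmorphB /= -[0]/(0%:C) (inj_eq (@complexI _)) subr_eq0.
  by rewrite eq_sym (negbTE lir).
rewrite [in RHS](be.2 x) scaler_sumr; apply: eq_bigr => i _.
rewrite scalerA; have [->//|/xr ->] := eqVneq (l i) r.
by rewrite !mulr0.
Qed.

(** The projection is defined by choice, so existence and uniqueness are both needed. The sum on the
    right meets the two conditions; conversely they force the coordinates, to 0 where [l i] differs
    from [r] and to those of [x] elsewhere, since [e i] is then an eigenvector. *)
Lemma spectral_proj_diagonal (r : R) x :
  spectral_proj dot A r x = \sum_(i | l i == r) dot x (e i) *: e i.
Proof.
have dotP y i : dot (\sum_(i | l i == r) dot y (e i) *: e i) (e i) =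
    if l i == r then dot y (e i) else 0.
  rewrite -(dot_sum_basis (fun i => if l i == r then dot y (e i) else 0)).
  congr (dot _ _); rewrite big_mkcond; apply: eq_bigr => j _.
  by case: ifP => //; rewrite scale0r.
pose P := [set y : H | A y = r%:C *: y /\
                      forall z : H, A z = r%:C *: z -> dot (x - y) z = 0].
have exP : exists y, P y.
  exists (\sum_(i | l i == r) dot x (e i) *: e i); split.
    by apply/diagonal_eigenvector => i; rewrite dotP => /negbTE ->.
  move=> z /diagonal_eigenvector zr.
  rewrite [z]be.2 linear_sumr /= big1// => i _; rewrite linearZr_LR /= linearBl.
  rewrite /= dotP; have [_|/zr ->] := eqVneq (l i) r.
    by rewrite subrr mulr0.
  by rewrite conjC0 mul0r.
have [/diagonal_eigenvector yr xy] := xgetPex 0 exP.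
change (xget 0 P = \sum_(i | l i == r) dot x (e i) *: e i).
rewrite [LHS](be.2 (xget 0 P)) [RHS]big_mkcond /=; apply: eq_bigr => i _.
have [lir|/yr ->] := eqVneq (l i) r; last by rewrite scale0r.
have /xy : A (e i) = r%:C *: e i by rewrite weighted_map_basis lir.
by rewrite linearBl => /eqP; rewrite subr_eq0 => /eqP ->.
Qed.

(** An inverse would have to map 0 to [e i]. *)
Lemma eigenvalue_spectrum i : spectrum A (l i).
Proof.
rewrite /spectrum /= => -[B [_ /(_ (e i)) BA _]].
have : B (A (e i) - (l i)%:C *: e i) = e i by exact: BA.
rewrite weighted_map_basis subrr linear0 => /esym ei0.
by have /eqP := be.1 i i; rewrite ei0 linear0r eqxx eq_sym oner_eq0.
Qed.

(** It is enough that every eigenvalue lies in the spectrum: at any other point of it the inner sum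
    is empty. *)
Lemma fsbig_spectrum (F : R -> I -> H) :
  \sum_(r \in spectrum A) \sum_(i | l i == r) F r i = \sum_i F (l i) i.
Proof.
pose s := undup [seq l i | i : I].
have sl i : l i \in s by rewrite mem_undup map_f// mem_enum.
have s_spec r : r \in s -> r \in spectrum A.
  rewrite mem_undup => /mapP[i _ ->]; rewrite inE.
  exact: eigenvalue_spectrum.
rewrite (fsbigE s) ?undup_uniq//; first last.
- move=> r _ rs; rewrite big1// => i /eqP lir.
  by rewrite -lir sl in rs.
- by move=> r /= /s_spec; rewrite inE.
rewrite big_seq_cond (eq_bigl (fun r => r \in s)); last first.
  by move=> r; apply/andb_idr/s_spec.
rewrite -big_seq (exchange_big_dep xpredT)//=; apply: eq_bigr => i _.
rewrite big_mkcond (bigD1_seq (l i)) ?undup_uniq//= eqxx big1 ?addr0//.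
by move=> r /negbTE rl; rewrite eq_sym rl.
Qed.

End basis.

(** Orthonormal columns make the new vectors orthonormal; orthonormal rows give the expansion, by
    summing over k first. *)
Lemma orthonormal_basis_unitary (I : finType) (e : I -> H) (u : I -> I -> C) :
  orthonormal_basis e ->
  (forall k k', \sum_i u i k * Num.conj (u i k') = (k == k')%:R) ->
  (forall i i', \sum_k u i k * Num.conj (u i' k) = (i == i')%:R) ->
  orthonormal_basis (fun k => \sum_i u i k *: e i).
Proof.
move=> be col row; have conj_dot x k :
    dot x (\sum_i u i k *: e i) = \sum_i Num.conj (u i k) * dot x (e i).
  by rewrite linear_sumr; apply: eq_bigr => i _; rewrite linearZr_LR.
split=> [k k'|x].
  rewrite conj_dot -col; apply: eq_bigr => i _.
  by rewrite dot_sum_basis// mulrC.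
rewrite [LHS](be.2 x); transitivity
    (\sum_k \sum_i \sum_i' (u i' k * Num.conj (u i k) * dot x (e i)) *: e i').
  rewrite exchange_big /=; apply: eq_bigr => i _.
  rewrite exchange_big /=.
  rewrite (eq_bigr (fun j => ((j == i)%:R * dot x (e i)) *: e j)); last first.
    by move=> j _; rewrite -scaler_suml -mulr_suml row.
  rewrite (bigD1 i)//= big1 => [|j /negbTE ->]; last by rewrite mul0r scale0r.
  by rewrite eqxx mul1r addr0.
apply: eq_bigr => k _; rewrite conj_dot scaler_suml; apply: eq_bigr => i _.
rewrite scaler_sumr; apply: eq_bigr => i' _.
by rewrite scalerA -mulrA mulrC.
Qed.

(** In the bases [f] and [e] the functional calculus is a Schur multiplier: the matrix of inner
    products of [f k] and [e i] is multiplied entrywise by [phi (l i, m k)]. *)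
Lemma funcalc_diagonal (I J : finType) (e : I -> H) (f : J -> H)
    (l : I -> R) (m : J -> R) (phi : R * R -> C) x :
  orthonormal_basis e -> orthonormal_basis f ->
  funcalc dot phi (weighted_map e e (fun i => (l i)%:C))
                  (weighted_map f f (fun k => (m k)%:C)) x =
  \sum_i (\sum_k phi (l i, m k) * (dot x (f k) * dot (f k) (e i))) *: e i.
Proof.
move=> be bf; rewrite /funcalc.
(* The right-hand side is grouped by the eigenvalues of the first operator, and further down by
   those of the second, to be compared term by term. *)
rewrite -(fsbig_spectrum be l (fun r i =>
  (\sum_k phi (r, m k) * (dot x (f k) * dot (f k) (e i))) *: e i)).
apply: eq_fsbigr => r _.
transitivity (\sum_k \sum_(i | l i == r)
    (phi (r, m k) * (dot x (f k) * dot (f k) (e i))) *: e i); last first.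
  by rewrite exchange_big; apply: eq_bigr => i _; rewrite scaler_suml.
rewrite -(fsbig_spectrum bf m (fun t k => \sum_(i | l i == r)
    (phi (r, t) * (dot x (f k) * dot (f k) (e i))) *: e i)).
apply: eq_fsbigr => t _; rewrite !spectral_proj_diagonal// exchange_big /=.
rewrite scaler_sumr; apply: eq_bigr => i _.
rewrite scalerA linear_sumlz mulr_sumr scaler_suml; apply: eq_bigr => k _.
by rewrite linearZl_LR.
Qed.

End diagonal_operators.

(** * Large commutators *)

Section shifted_pair.
Local Open Scope complex_scope.
Variables (R : realType) (n : nat).
Hypothesis n_gt1 : (1 < n)%N.
Local Notation C := R[i].
Local Notation index := (bool * 'I_n)%type.

Let n_gt0 : (0 < n)%N. Proof. exact: ltnW. Qed.
Let n_neq0 : n%:R != 0 :> C. Proof. by rewrite pnatr_eq0 -lt0n. Qed.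

(** Two diagonal blocks, each the unitary Fourier matrix; the boolean selects the block. *)
Definition fourier_coef (p q : index) : C :=
  (p.1 == q.1)%:R * (sqrtC n%:R)^-1 * zeta R n ^+ (p.2 * q.2).

Lemma fourier_coef_unitary p q :
  \sum_r fourier_coef p r * Num.conj (fourier_coef q r) = (p == q)%:R.
Proof.
case: p q => [s j] [t k].
rewrite -(pair_bigA _ (fun a b => fourier_coef (s, j) (a, b) *
  Num.conj (fourier_coef (t, k) (a, b)))) /=.
rewrite (eq_bigr (fun a => ((s == a) && (t == a))%:R * (j == k)%:R)).
  rewrite -mulr_suml xpair_eqE; have [<-|st] := eqVneq s t.
    rewrite (bigD1 s)//= eqxx big1 ?addr0 ?mul1r// => a.
    by rewrite andbb eq_sym => /negbTE ->.
  rewrite big1 ?mul0r// => a _; case: eqVneq => //= <-.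
  by rewrite eq_sym (negbTE st).
move=> a _; rewrite -mulnb natrM /fourier_coef /=.
transitivity ((s == a)%:R * (t == a)%:R * (n%:R^-1 *
    \sum_(l < n) zeta R n ^+ (j * l) * Num.conj (zeta R n ^+ (k * l)))).
  rewrite !mulr_sumr; apply: eq_bigr => l _.
  have -> : (n%:R : C)^-1 = (sqrtC n%:R)^-1 * (sqrtC n%:R)^-1.
    by rewrite -invfM -expr2 sqrtCK.
  rewrite !rmorphM /= conjC_nat fmorphV /=.
  rewrite [Num.conj (sqrtC _)]geC0_conj ?sqrtC_ge0//; ring.
by rewrite zeta_orthogonality_ord (mulrC (j == k)%:R) mulKf.
Qed.

Lemma fourier_coef_sym p q : fourier_coef p q = fourier_coef q p.
Proof. by rewrite /fourier_coef eq_sym mulnC. Qed.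

Lemma sum_index (V : nmodType) (F : index -> V) :
  \sum_p F p = \sum_j F (true, j) + \sum_j F (false, j).
Proof.
rewrite (eq_bigr (fun p => F (p.1, p.2))) => [|[]//].
by rewrite -(pair_bigA _ (fun s j => F (s, j))) big_bool.
Qed.

Section operators.
Context {H : completeNormedModType C} {dot : {dot H for (@Num.conj C)}}.
Hypothesis hd : hilbert_dot dot.
Variable e : index -> H.
Hypothesis be : orthonormal_basis (dot := dot) e.

Definition fourier_basis (q : index) : H := \sum_p fourier_coef p q *: e p.
Local Notation f := fourier_basis.

Lemma fourier_basisP : orthonormal_basis (dot := dot) f.
Proof.
apply: orthonormal_basis_unitary => // p q; last exact: fourier_coef_unitary.
rewrite -fourier_coef_unitary; apply: eq_bigr => r _.
by rewrite !(fourier_coef_sym r).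
Qed.

(** The boolean is read as 0 or 1: it adds 2 pi to the eigenvalues of [B] on the summand [true] and,
    as the weight of [Q], annihilates the summand [false]. *)
Local Notation A :=
  (weighted_map (dot := dot) e e (fun p => (2 * pi * p.2%:R : R)%:C)).
Local Notation B :=
  (weighted_map (dot := dot) f f (fun p => (2 * pi * (p.2 + p.1)%:R : R)%:C)).
Local Notation Q :=
  (weighted_map (dot := dot) e (fun p => e (false, p.2)) (fun p => p.1%:R)).

(** Both summands carry the same Fourier matrix, so [Q] acts on the basis [f] as it does on [e]. *)
Lemma shift_fourier_basis p : Q (f p) = p.1%:R *: f (false, p.2).
Proof.
rewrite /fourier_basis linear_sum.
rewrite (eq_bigr (fun q => (fourier_coef q p * q.1%:R) *: e (false, q.2))).
  rewrite !sum_index /= [X in _ + X]big1 ?addr0; last first.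
    by move=> j _; rewrite mulr0 scale0r.
  rewrite scalerDr !scaler_sumr [X in _ = X + _]big1 ?add0r; last first.
    by move=> j _; rewrite /fourier_coef /= !mul0r scale0r scaler0.
  case: p => [t k]; apply: eq_bigr => j _; rewrite scalerA.
  by rewrite /fourier_coef /=; case: t; rewrite /= ?mulr1 ?mul1r ?mul0r.
by move=> q _; rewrite linearZ /= weighted_map_basis// scalerA.
Qed.

(** The eigenvalues of [A] do not depend on the summand. *)
Lemma commutator_diagonal_shift x : commutator A Q x = 0.
Proof.
apply/eqP; rewrite subr_eq0; apply/eqP.
apply: (linear_basis_ext be (T := A \o Q) (S := Q \o A)) => p /=.
rewrite !weighted_map_basis// !linearZ /= !weighted_map_basis//.
by rewrite !scalerA mulrC.
Qed.

(** On [f (true, k)] the eigenvalue of [B] is 2 pi (k + 1) before [Q] is applied and 2 pi k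
    after. *)
Lemma commutator_fourier_shift x : commutator B Q x = - (2 * pi : R)%:C *: Q x.
Proof.
apply: (linear_basis_ext fourier_basisP (T := (B \o Q) \- (Q \o B))
  (S := (- (2 * pi : R)%:C) \*: Q)) => p /=.
have BQ : B (Q (f p)) =
    p.1%:R *: ((2 * pi * (p.2 + false)%:R : R)%:C *: f (false, p.2)).
  rewrite shift_fourier_basis linearZ /= weighted_map_basis//.
  exact: fourier_basisP.
have QB : Q (B (f p)) =
    (2 * pi * (p.2 + p.1)%:R : R)%:C *: (p.1%:R *: f (false, p.2)).
  rewrite weighted_map_basis; last exact: fourier_basisP.
  by rewrite linearZ /= shift_fourier_basis.
rewrite {}BQ {}QB shift_fourier_basis !scalerA -scalerBl; congr (_ *: _).
case: p => -[] k /=; last by rewrite !mul0r !mulr0 subrr.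
by rewrite addn0 !mul1r !mulr1 -rmorphB -rmorphN natrD; congr _%:C; ring.
Qed.

Lemma norm_shift x : `|Q x| <= `|x|.
Proof.
have -> : Q x = \sum_p (if p.1 then 0 else dot x (e (true, p.2))) *: e p.
  rewrite /weighted_map !sum_index /= [X in _ + X]big1 ?addr0; last first.
    by move=> j _; rewrite mul0r scale0r.
  rewrite [X in _ = X + _]big1 ?add0r; last by move=> j _; rewrite scale0r.
  by apply: eq_bigr => j _; rewrite mul1r.
rewrite -ler_sqr ?nnegrE// (norm_sum_basis hd be) (parseval hd be).
rewrite !sum_index /=.
rewrite [X in X + _]big1 ?add0r; last by move=> j _; rewrite normr0 expr0n.
by rewrite lerDl; apply: sumr_ge0 => j _; exact: exprn_ge0.
Qed.

Variable phi : R * R -> C.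
(** The nodes go beyond the indices below n, since the shifted part of [B] has the eigenvalue 2 pi
    n. *)
Hypothesis phi_nodes : forall j k : nat,
  phi (2 * pi * j%:R, 2 * pi * k%:R) = Num.conj (zeta R n ^+ (j * k)).

Variables (o : 'I_n) (o0 : o = 0%N :> nat).

(** In the basis [f] the vector [e (s, o)] has coefficients 1 / sqrt n on its own summand. The value
    of [phi] at the node (j, k + s) cancels the phase zeta^(jk) of the Fourier matrix, so n equal
    terms of modulus 1/n add up. *)
Lemma funcalc_basis_vector s :
  funcalc dot phi A B (e (s, o)) =
  \sum_(j < n) Num.conj (zeta R n ^+ (j * s)) *: e (s, j).
Proof.
rewrite funcalc_diagonal//; last exact: fourier_basisP.
transitivity (\sum_(p : index)
    ((p.1 == s)%:R * Num.conj (zeta R n ^+ (p.2 * s))) *: e p).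
  apply: eq_bigr => -[t j] _ /=; congr (_ *: _).
  have dot_f p q : dot (f q) (e p) = fourier_coef p q by rewrite dot_sum_basis.
  rewrite (eq_bigr (fun q : index => ((t == q.1) && (s == q.1))%:R * (n%:R^-1 *
      Num.conj (zeta R n ^+ (j * s))))).
    rewrite -mulr_suml -(pair_bigA _ (fun a b => ((t == a) && (s == a))%:R)) /=.
    rewrite (bigD1 t)//= [X in _ + X]big1 ?addr0; last first.
      by move=> a; rewrite eq_sym => /negbTE ->; rewrite big1.
    rewrite eqxx /= sumr_const card_ord (eq_sym s) -[_ *+ n]mulr_natr.
    by rewrite -mulrA mulVKf.
  move=> [a k] _ /=; rewrite phi_nodes (hermC _ (e _)) expr0 mul1r /= !dot_f.
  rewrite /fourier_coef /= o0 mul0n expr0 mulr1 rmorphM /= conjC_nat fmorphV /=.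
  rewrite [Num.conj (sqrtC _)]geC0_conj ?sqrtC_ge0//.
  have -> : (n%:R : C)^-1 = (sqrtC n%:R)^-1 * (sqrtC n%:R)^-1.
    by rewrite -invfM -expr2 sqrtCK.
  rewrite -mulnb natrM.
  have [<-|] := eqVneq s a; last by rewrite !(mul0r, mulr0).
  rewrite mulnDr exprD rmorphM /=.
  have zz : Num.conj (zeta R n ^+ (j * k)) * zeta R n ^+ (j * k) = 1.
    by rewrite mulrC -normCK normrX norm_zeta !expr1n.
  rewrite -[RHS]mulr1 -zz; ring.
rewrite sum_index; case: s => /=.
  rewrite [X in _ + X]big1 ?addr0; last by move=> j _; rewrite mul0r scale0r.
  by apply: eq_bigr => j _; rewrite mul1r.
rewrite [X in X + _]big1 ?add0r; last by move=> j _; rewrite mul0r scale0r.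
by apply: eq_bigr => j _; rewrite mul1r.
Qed.

Lemma norm_commutator_funcalc :
  `|commutator (funcalc dot phi A B) Q (e (true, o))| ^+ 2 = n%:R *+ 2.
Proof.
have QS : Q (\sum_(j < n) Num.conj (zeta R n ^+ (j * true)) *: e (true, j)) =
    \sum_(j < n) Num.conj (zeta R n ^+ j) *: e (false, j).
  rewrite linear_sum; apply: eq_bigr => j _.
  by rewrite linearZ /= weighted_map_basis// scale1r muln1.
rewrite /commutator weighted_map_basis// scale1r !funcalc_basis_vector QS.
rewrite -sumrB (eq_bigr (fun j : 'I_n =>
    (1 - Num.conj (zeta R n ^+ j)) *: e (false, j))).
  rewrite (_ : \sum_j _ = \sum_(p : index)
      (if p.1 then 0 else 1 - Num.conj (zeta R n ^+ p.2)) *: e p); last first.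
    rewrite sum_index /= [X in _ = X + _]big1 ?add0r//.
    by move=> j _; rewrite scale0r.
  rewrite (norm_sum_basis hd be) sum_index /=.
  rewrite [X in X + _]big1 ?add0r; last first.
    by move=> j _; rewrite normr0 expr0n.
  (* The cross terms of |1 - zeta^(-j)|^2 are written as products of the characters 0 and 1, whose
     sums vanish because 0 and 1 differ modulo n > 1. *)
  rewrite (eq_bigr (fun j : 'I_n => 2 - (zeta R n ^+ (1 * j) *
      Num.conj (zeta R n ^+ (0 * j)) + zeta R n ^+ (0 * j) *
      Num.conj (zeta R n ^+ (1 * j))))).
    rewrite sumrB [X in _ - X]big_split /= !zeta_orthogonality//.
    rewrite !mod0n (modn_small n_gt1) /= !mul0r addr0 subr0.
    by rewrite sumr_const card_ord mulrnAC.
  move=> j _; rewrite normCK rmorphB /= !conjCK mul1n mul0n expr0 conjC1.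
  rewrite mulr1 mul1r mulrBl mul1r mulrBr mulr1.
  have -> : Num.conj (zeta R n ^+ j) * zeta R n ^+ j = 1.
    by rewrite mulrC -normCK normrX norm_zeta !expr1n.
  ring.
by move=> j _; rewrite muln0 expr0 conjC1 -scalerBl.
Qed.

End operators.

End shifted_pair.

(** * Trigonometric polynomials with frequencies in an annulus *)

Section trigonometric_polynomials.
Local Open Scope complex_scope.
Variable R : realType.
Local Notation C := R[i].
Local Notation plane := (R * R)%type.
Local Notation modulus := Normc.normc.
Local Notation mu2 := (@plane_measure R).
Local Notation conv := Defs.conv.
Variables (w : R -> R) (W : int -> plane -> C).
Hypotheses (hw : besov_cutoff w) (hW : besov_kernels w W).

(* Strict inequalities keep [2^-n * s] away from the endpoints of the support
   of [w], so that exactly two consecutive [n] contribute. *)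
Lemma cutoff_annulus (s : R) (n : int) : 4 < s < 8 -> n != 2 -> n != 3 ->
  w (2%:R ^ (- n) * s) = 0.
Proof.
move=> /andP[s4 s8] n2 n3; case: hw => _ _ w0 _; apply: w0.
have [n1|n4] := leP n 1.
  have : (2%:R : R) ^ (- 1) <= 2%:R ^ (- n) by rewrite ler_eXz2l ?ltr1n// lerN2.
  rewrite exprN1; move: (_ ^ (- n)) => p p2.
  by rewrite negb_and -!ltNge; apply/orP; right; nra.
have {n2 n3}n4 : 4 <= n by move: n4 n2 n3; lia.
have : (2%:R : R) ^ (- n) <= 2%:R ^ (- (4 : int)).
  by rewrite ler_eXz2l ?ltr1n// lerN2.
rewrite -[X in _ <= X]exprnN -natrX.
have : 0 < (2%:R : R) ^ (- n) by rewrite exprz_gt0.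
move: (_ ^ (- n)) => p p0 p16.
by rewrite negb_and -!ltNge; apply/orP; left; nra.
Qed.

(** The functional equation of [w] at s / 4, which lies in [1, 2]. *)
Lemma cutoff_partition (s : R) : 4 < s < 8 ->
  w (2%:R ^ (- (2 : int)) * s) + w (2%:R ^ (- (3 : int)) * s) = 1.
Proof.
move=> /andP[s4 s8]; case: hw => _ _ _ w1.
have -> : (2%:R : R) ^ (- (2 : int)) = 4^-1 by rewrite -exprnN -natrX.
have -> : (2%:R : R) ^ (- (3 : int)) = 8^-1 by rewrite -exprnN -natrX.
rewrite w1; last by apply/andP; split; lra.
by rewrite mulrAC -invfM -natrM subrK.
Qed.

Variables (T : finType) (c : T -> C) (xi : T -> plane).
Hypothesis xi_annulus : forall t, 4 < enorm (xi t) < 8.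

Definition trigpoly (x : plane) : C := \sum_t c t * expi (dotp (xi t) x).
Local Notation phi := trigpoly.

Hypothesis phi_le1 : forall x, modulus (phi x) <= 1.

Lemma dotp_continuous (a : plane) : continuous (dotp a).
Proof.
move=> x; apply: cvgD.
  by apply: cvgM; [exact: cvg_cst|exact: cvg_fst].
by apply: cvgM; [exact: cvg_cst|exact: cvg_snd].
Qed.

Lemma trigpoly_ccontinuous : ccontinuous phi.
Proof.
apply: ccontinuous_sum => t; apply: ccontinuousM; first exact: ccontinuous_cst.
by apply: ccontinuous_expi; exact: dotp_continuous.
Qed.

Lemma modulusM (a b : C) : modulus (a * b) = modulus a * modulus b.
Proof. exact: Normc.normcM. Qed.

Lemma modulus_ge0 (a : C) : 0 <= modulus a.
Proof. by case: a => u v; exact: sqrtr_ge0. Qed.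

(** Serves at once for the convolutions, for temperedness and for the pairing with a derivative in
    the gradient condition. *)
Lemma bounded_schwartz_integrable (g f : plane -> C) (s : seq bool) (M : R) :
  ccontinuous g -> (forall x, modulus (g x) <= M) -> schwartz f ->
  (size s <= 4)%N ->
  cintegrable (fun x => g x * partials s f x) /\
  modulus (cintegral (fun x => g x * partials s f x)) <=
    M * fine (schwartz_seminorm 4 f) * Rintegral mu2 setT decay *+ 2.
Proof.
move=> cg gM sf s4; apply: ccontinuous_decay_integrable.
  by apply: ccontinuousM => //; exact: schwartz_partial_ccontinuous.
move=> x; rewrite modulusM -mulrA.
by apply: ler_pM; rewrite ?modulus_ge0// schwartz_decay.
Qed.

(** An explicit majorant of the L^1 norm of [W n]. *)
Definition kernel_bound n : R :=
  fine (schwartz_seminorm 4 (W n)) * Rintegral mu2 setT decay *+ 2.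

Lemma reflect_continuous (x : plane) : continuous (fun z : plane => x - z).
Proof. by move=> z; apply: cvgB; [exact: cvg_cst|exact: cvg_id]. Qed.

(** Moving the translation from the kernel to [phi] leaves a fixed Schwartz function in the
    integrand, so the bound is uniform in [x]. *)
Lemma conv_reflect n x : cintegrable (fun z => phi (x - z) * W n z) /\
  conv (regular_distr phi) (W n) x = cintegral (fun z => phi (x - z) * W n z) /\
  modulus (conv (regular_distr phi) (W n) x) <= kernel_bound n.
Proof.
have [sW _] := hW n.
have [iW bW] := @bounded_schwartz_integrable (fun z => phi (x - z)) (W n) [::] 1
  (ccontinuous_comp trigpoly_ccontinuous (@reflect_continuous x))
  (fun z => phi_le1 (x - z)) sW isT.
have cE : conv (regular_distr phi) (W n) x =
    cintegral (fun z => phi (x - z) * W n z).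
  rewrite -(cintegral_reflect x iW); apply: eq_cintegral => y /=.
  by rewrite subKr.
by rewrite cE /kernel_bound -[fine _]mul1r.
Qed.

(** Convolution with [W n] multiplies an exponential of frequency xi by the Fourier transform of
    [W n] at xi. *)
Lemma conv_trigpoly n x : conv (regular_distr phi) (W n) x =
  \sum_t (w (2%:R ^ (- n) * enorm (xi t)))%:C * (c t * expi (dotp (xi t) x)).
Proof.
have [_ [-> _]] := conv_reflect n x; have [sW fW] := hW n.
pose F t z : C := W n z * expi (- dotp z (xi t)).
have iF t : cintegrable (F t).
  have cexp : ccontinuous (fun z : plane => expi (- dotp z (xi t))).
    apply: ccontinuous_expi => z; apply: cvgN; apply: cvgD.
      by apply: cvgM; [exact: cvg_fst|exact: cvg_cst].
    by apply: cvgM; [exact: cvg_snd|exact: cvg_cst].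
  have nexp (z : plane) : modulus (expi (- dotp z (xi t))) <= 1.
    by rewrite /= cos2Dsin2 sqrtr1.
  rewrite /F; under eq_fun do rewrite mulrC.
  exact: (@bounded_schwartz_integrable _ (W n) [::] 1 cexp nexp sW isT).1.
transitivity (cintegral (fun z => \sum_t (c t * expi (dotp (xi t) x)) * F t z)).
  apply: eq_cintegral => z; rewrite mulr_suml; apply: eq_bigr => t _.
  rewrite (_ : dotp (xi t) (x - z) = dotp (xi t) x + - dotp z (xi t)).
    by rewrite expiD /F; ring.
  by rewrite /dotp /=; ring.
rewrite cintegral_sum; last by move=> t; exact: cintegrableZ.
by apply: eq_bigr => t _; rewrite cintegralZ// -fW mulrC.
Qed.

Lemma conv_trigpoly_eq0 n x : n != 2 -> n != 3 ->
  conv (regular_distr phi) (W n) x = 0.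
Proof.
move=> n2 n3; rewrite conv_trigpoly big1// => t _.
by rewrite cutoff_annulus// mul0r.
Qed.

Lemma conv_trigpoly_partition x :
  conv (regular_distr phi) (W 2) x + conv (regular_distr phi) (W 3) x = phi x.
Proof.
rewrite !conv_trigpoly -big_split; apply: eq_bigr => t _ /=.
by rewrite -mulrDl -rmorphD /= cutoff_partition// mul1r.
Qed.

Lemma conv_trigpoly_ccontinuous n :
  ccontinuous (conv (regular_distr phi) (W n)).
Proof.
rewrite (_ : conv _ _ = fun x => \sum_t (w (2%:R ^ (- n) * enorm (xi t)))%:C *
  (c t * expi (dotp (xi t) x))); last exact/funext/conv_trigpoly.
apply: ccontinuous_sum => t; apply: ccontinuousM; first exact: ccontinuous_cst.
apply: ccontinuousM; first exact: ccontinuous_cst.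
by apply: ccontinuous_expi; exact: dotp_continuous.
Qed.

Lemma Lnorm_infty_le (g : plane -> R) (B : R) :
  0 <= B -> (forall x, `|g x| <= B) ->
  (Lnorm mu2 +oo (fun x => (g x)%:E) <= B%:E)%E.
Proof.
(* The norm is an essential supremum, with value 0 by convention on a space of measure zero. *)
move=> B0 gB; rewrite unlock; case: ifP => _; last by rewrite lee_fin.
by apply/ess_sup_inf.ess_supP; apply/nearW => x /=; rewrite lee_fin.
Qed.

(* Independent of [T], [c] and [xi]: this uniformity is the point of keeping
   the frequencies in a fixed annulus. *)
Definition besov_bound : R := 4 * kernel_bound 2 + 8 * kernel_bound 3.

Lemma besov_norm_trigpoly :
  (besov_norm W (regular_distr phi) <= besov_bound%:E)%E.
Proof.
pose F (n : int) : \bar R := ((2%:R ^ n)%:E *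
  Lnorm mu2 +oo (fun x => (modulus (conv (regular_distr phi) (W n) x))%:E))%E.
rewrite -[leLHS]/(\esum_(n in [set: int]) F n)%E.
have F0 n : (0 <= F n)%E by rewrite mule_ge0 ?Lnorm_ge0// lee_fin exprz_ge0.
have Fle n : (F n <= ((2%:R : R) ^ n * kernel_bound n)%:E)%E.
  have p0 : 0 <= (2%:R : R) ^ n by rewrite exprz_ge0.
  rewrite /F EFinM lee_wpmul2l ?lee_fin//; apply: Lnorm_infty_le.
    have [_ [_]] := conv_reflect n (0, 0).
    by apply: le_trans; exact: modulus_ge0.
  move=> x; rewrite ger0_norm ?modulus_ge0//.
  by have [_ [_]] := conv_reflect n x.
have Feq0 n : n != 2 -> n != 3 -> F n = 0%E.
  move=> n2 n3; apply/eqP; rewrite eq_le F0 andbT /F.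
  have p0 : 0 <= (2%:R : R) ^ n by rewrite exprz_ge0.
  rewrite -[leRHS](mule0 ((2%:R : R) ^ n)%:E) lee_wpmul2l ?lee_fin//.
  apply: Lnorm_infty_le => // x; rewrite conv_trigpoly_eq0//.
  by rewrite Normc.normc0 normr0.
rewrite (esumID [set 2 : int])// !setTI esum_set1//.
rewrite (esumID [set 3 : int])// [X in (_ + (_ + X))%E]esum1 ?adde0; last first.
  by move=> n [/= /eqP n2 /eqP n3]; exact: Feq0.
rewrite (_ : _ `&` _ = [set 3 : int]); last first.
  by apply/seteqP; split=> [n []//|n /= ->].
rewrite esum_set1// /besov_bound EFinD leeD//.
  by apply: (le_trans (Fle 2)); rewrite lee_fin -exprnP -natrX.
by apply: (le_trans (Fle 3)); rewrite lee_fin -exprnP -natrX.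
Qed.

Lemma sum_two_consecutive (V : nmodType) (F : nat -> V) (a m : nat) :
  (a.+1 < m)%N -> (forall k, k != a -> k != a.+1 -> F k = 0) ->
  \sum_(k < m) F k = F a + F a.+1.
Proof.
move=> am F0; have am' : (a < m)%N by exact: ltnW.
rewrite (bigD1 (Ordinal am'))//= (bigD1 (Ordinal am))/=; last first.
  by rewrite -val_eqE /= gtn_eqF.
rewrite big1 ?addr0// => k /andP[ka ka1]; apply: F0.
  by rewrite -val_eqE in ka.
by rewrite -val_eqE in ka1.
Qed.

Lemma besov_function_trigpoly : besov_function W phi.
Proof.
have iphi f s : schwartz f -> (size s <= 4)%N ->
    cintegrable (fun x => phi x * partials s f x).
  move=> sf s4.
  by have [] := bounded_schwartz_integrable trigpoly_ccontinuous phi_le1 sf s4.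
split; first exact: trigpoly_ccontinuous.
  by move=> f sf; exact: (iphi f [::]).
split.
- split=> [a f g sf sg|].
    have intf : cintegrable (fun x => phi x * f x) by exact: (iphi f [::]).
    have intg : cintegrable (fun x => phi x * g x) by exact: (iphi g [::]).
    rewrite /regular_distr -(cintegralZ a intf) -cintegralD//; last first.
      exact: cintegrableZ.
    by apply: eq_cintegral => x; ring.
  exists (Rintegral mu2 setT decay *+ 2), 4%N => f sf.
  have [_ bf] := @bounded_schwartz_integrable phi f [::] 1
    trigpoly_ccontinuous phi_le1 sf isT.
  have sn_fin : schwartz_seminorm 4 f \is a fin_num.
    rewrite ge0_fin_numE; first by have [_] := sf; exact.
    apply: (@le_trans _ _ ((1 + enorm (0, 0)) ^+ 4 * modulus (f (0, 0)))%:E).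
      rewrite lee_fin mulr_ge0 ?modulus_ge0// exprn_ge0// addr_ge0//.
      exact: sqrtr_ge0.
    by apply: ereal_sup_ubound; exists ([::], (0, 0)).
  by rewrite -(fineK sn_fin) -EFinM lee_fin mulrC mulrnAr -[fine _]mul1r.
- by apply: le_lt_trans besov_norm_trigpoly _; exact: ltry.
(* The symmetric partial sums are eventually exact: once they contain the indices 2 and 3, the
   difference is 0. *)
- move=> i f sf; apply: cvg_near_cst.
  have iconv n :
      cintegrable (fun x => conv (regular_distr phi) (W n) x * partial i f x).
    have [] := bounded_schwartz_integrable (conv_trigpoly_ccontinuous n)
      (fun x => (conv_reflect n x).2.2) sf (isT : size [:: i] <= 4)%N.
    by [].
  near=> N.
  (* The indices 2 and 3 sit at k = N + 2 and N + 3, and N + 3 < 2N + 1 requires N >= 3. *)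
  have N3 : (3 <= N)%N by near: N; exact: nbhs_infty_ge.
  rewrite (@sum_two_consecutive _ (fun k => distr_partial i
    (regular_distr (conv (regular_distr phi) (W (k%:Z - N%:Z)))) f) N.+2);
    first last.
  + move=> k kN2 kN3; rewrite /distr_partial /regular_distr.
    rewrite (_ : cintegral _ = 0) ?oppr0// -[RHS]cintegral0.
    apply: eq_cintegral => x; rewrite conv_trigpoly_eq0 ?mul0r//.
      by apply: contra kN2 => /eqP ?; apply/eqP; lia.
    by apply: contra kN3 => /eqP ?; apply/eqP; lia.
  + by move: N3; lia.
  rewrite (_ : N.+2%:Z - N%:Z = 2); last by lia.
  rewrite (_ : N.+3%:Z - N%:Z = 3); last by lia.
  rewrite /distr_partial /regular_distr -opprD -cintegralD.
  + rewrite (_ : _ - _ = 0) ?Normc.normc0//.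
    apply/eqP; rewrite subr_eq0 eqr_opp; apply/eqP; apply: eq_cintegral => x.
    by rewrite -mulrDl conv_trigpoly_partition.
  + exact: iconv.
  + exact: iconv.
Unshelve. all: by end_near. Qed.

End trigonometric_polynomials.

(** * Fejer interpolation *)

Section fejer_interpolation.
Local Open Scope complex_scope.
Variables (R : realType) (n : nat).
Hypothesis n_gt0 : (0 < n)%N.
Local Notation C := R[i].
Local Notation z := (zeta R n).
Local Notation modulus := Normc.normc.

Let n_neq0 : n%:R != 0 :> C. Proof. by rewrite pnatr_eq0 -lt0n. Qed.

Definition frequency (p : 'I_n * 'I_n) : R := (p.1%:R - p.2%:R) / n%:R.

Definition fejer_coef (j : nat) (p : 'I_n * 'I_n) : C :=
  n%:R ^- 2 * (Num.conj (z ^+ (j * p.1)) * z ^+ (j * p.2)).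

(** The Fejer kernel of period 2 pi n centred at the node 2 pi j and equal to 1 there, expanded into
    exponentials so that products fit [trigpoly]. *)
Definition fejer (j : nat) (x : R) : C :=
  \sum_p fejer_coef j p * expi (frequency p * x).

Definition dirichlet (j : nat) (x : R) : C :=
  \sum_(l < n) Num.conj (z ^+ (j * l)) * expi (l%:R / n%:R * x).

Lemma fejerE j x : fejer j x = n%:R ^- 2 * `|dirichlet j x| ^+ 2.
Proof.
rewrite normCK /dirichlet rmorph_sum big_distrlr /= pair_bigA mulr_sumr.
apply: eq_bigr => p _; rewrite /fejer_coef rmorphM /= conjCK expi_conj.
rewrite (_ : frequency p * x = p.1%:R / n%:R * x + - (p.2%:R / n%:R * x)).
  by rewrite expiD; ring.
by rewrite /frequency; ring.
Qed.

Lemma fejer_ge0 j x : 0 <= fejer j x.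
Proof. by rewrite fejerE mulr_ge0 ?exprn_ge0// invr_ge0 exprn_ge0. Qed.

(** Summation over the nodes removes all pairs of distinct indices; each of the n diagonal pairs
    contributes 1/n. *)
Lemma fejer_partition x : \sum_(j < n) fejer j x = 1.
Proof.
rewrite exchange_big /= (eq_bigr (fun p : 'I_n * 'I_n =>
    (p.1 == p.2)%:R * n%:R^-1)) => [|[l m] _ /=]; last first.
  rewrite -mulr_suml -mulr_sumr.
  rewrite (eq_bigr (fun j : 'I_n => z ^+ (m * j) * Num.conj (z ^+ (l * j)))).
    rewrite zeta_orthogonality_ord eq_sym.
    have [<-|_] := eqVneq l m; last by rewrite !(mul0r, mulr0).
    rewrite /frequency subrr !mul0r expi0 mulr1 !mul1r.
    by rewrite expr2 invfM -mulrA mulVf// mulr1.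
  by move=> j _; rewrite mulrC !(mulnC j).
rewrite -(pair_bigA _ (fun l m => (l == m)%:R * n%:R^-1)) /=.
rewrite (eq_bigr (fun=> n%:R^-1)) => [|l _].
  by rewrite sumr_const card_ord -[_ *+ n]mulr_natr mulVf.
rewrite (bigD1 l)//= eqxx mul1r big1 ?addr0// => m.
by rewrite eq_sym => /negbTE ->; rewrite mul0r.
Qed.

(** At a node the Dirichlet sum is a character sum, with value n or 0. *)
Lemma fejer_node j m : fejer j (2 * pi * m%:R) = (j == m %[mod n])%:R.
Proof.
rewrite fejerE /dirichlet.
rewrite (eq_bigr (fun l : 'I_n => z ^+ (m * l) * Num.conj (z ^+ (j * l)))).
  rewrite zeta_orthogonality// normrM !normr_nat exprMn mulrCA mulVf ?mulr1.
    by rewrite eq_sym; case: eqP; rewrite ?expr1n ?expr0n.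
  by rewrite expf_neq0.
move=> l _; rewrite mulrC; congr (_ * _).
rewrite /zeta expiXn; congr expi.
by rewrite -[_ / _ *+ _]mulr_natr natrM; ring.
Qed.

Definition interpolant_coef
    (t : ('I_n * 'I_n) * (('I_n * 'I_n) * ('I_n * 'I_n))) : C :=
  Num.conj (z ^+ (t.1.1 * t.1.2)) *
  (fejer_coef t.1.1 t.2.1 * fejer_coef t.1.2 t.2.2).

(* The modulation by [6] moves the Fejer frequencies, which fill the square
   (-1, 1)^2, into the annulus 4 < |xi| < 8; it is invisible at the nodes,
   which lie in 2 pi Z. *)
Definition interpolant_frequency
    (t : ('I_n * 'I_n) * (('I_n * 'I_n) * ('I_n * 'I_n))) : R * R :=
  (6 + frequency t.2.1, frequency t.2.2).

Definition interpolant : R * R -> C :=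
  trigpoly interpolant_coef interpolant_frequency.

Lemma interpolantE x : interpolant x = expi (6 * x.1) *
  \sum_(q : 'I_n * 'I_n)
     Num.conj (z ^+ (q.1 * q.2)) * (fejer q.1 x.1 * fejer q.2 x.2).
Proof.
rewrite /interpolant /trigpoly -(pair_bigA _ (fun q p =>
  interpolant_coef (q, p) * expi (dotp (interpolant_frequency (q, p)) x))) /=.
rewrite mulr_sumr; apply: eq_bigr => q _.
rewrite /fejer big_distrlr /= pair_bigA !mulr_sumr; apply: eq_bigr => p _.
rewrite /interpolant_coef /interpolant_frequency /dotp /=.
rewrite (_ : (6 + frequency p.1) * x.1 + frequency p.2 * x.2 =
  6 * x.1 + (frequency p.1 * x.1 + frequency p.2 * x.2)); last by ring.
by rewrite !expiD; ring.
Qed.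

(** Up to the unimodular modulation, this is a convex combination of node values of modulus 1. *)
Lemma interpolant_le1 x : modulus (interpolant x) <= 1.
Proof.
rewrite -lecR -[leLHS]/(`|interpolant x|).
rewrite interpolantE normrM norm_expi mul1r.
apply: (le_trans (ler_norm_sum _ _ _)).
rewrite (eq_bigr (fun q : 'I_n * 'I_n => fejer q.1 x.1 * fejer q.2 x.2)).
  rewrite -(pair_bigA _ (fun j k : 'I_n => fejer j x.1 * fejer k x.2)) /=.
  by rewrite -big_distrlr /= !fejer_partition mulr1.
move=> q _; rewrite normrM norm_conjC normrX norm_zeta expr1n mul1r.
by rewrite ger0_norm// mulr_ge0// fejer_ge0.
Qed.

Lemma interpolant_node (j k : nat) :
  interpolant (2 * pi * j%:R, 2 * pi * k%:R) = Num.conj (z ^+ (j * k)).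
Proof.
rewrite interpolantE /=.
rewrite (_ : 6 * (2 * pi * j%:R) = 2 * pi *+ (6 * j) :> R); last first.
  by rewrite -[in RHS]mulr_natr natrM; ring.
rewrite expi_2piMn mul1r.
have lt_mod m : (m %% n < n)%N by rewrite ltn_mod.
(* Only the term indexed by the residues of j and k survives, and zeta^(jk) depends only on these
   residues. *)
rewrite (bigD1 (Ordinal (lt_mod j), Ordinal (lt_mod k)))//= big1 ?addr0.
  rewrite !fejer_node !modn_mod !eqxx !mulr1.
  rewrite -[X in Num.conj X](prim_expr_mod (zeta_prim R n_gt0)).
  by rewrite modnMml modnMmr prim_expr_mod// zeta_prim.
move=> [a b] ab; rewrite !fejer_node /=.
rewrite (modn_small (ltn_ord a)) (modn_small (ltn_ord b)).
case: eqP => ja; last by rewrite mul0r mulr0.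
case: eqP => kb; last by rewrite !mulr0.
by case/eqP: ab; congr (_, _); apply: val_inj.
Qed.

Lemma frequency_lt1 p : -1 < frequency p < 1.
Proof.
have nR : 0 < n%:R :> R by rewrite ltr0n.
have lt_n (l : 'I_n) : l%:R < n%:R :> R by rewrite ltr_nat.
rewrite /frequency ltr_pdivlMr// ltr_pdivrMr//.
have := lt_n p.1; have := lt_n p.2; have := ler0n R p.1; have := ler0n R p.2.
by move=> ? ? ? ?; apply/andP; split; lra.
Qed.

(** The first coordinate lies in (5, 7) and the second in (-1, 1), so the squared norm is between 25
    and 50, inside (16, 64). *)
Lemma interpolant_annulus t : 4 < enorm (interpolant_frequency t) < 8.
Proof.
have /andP[a1 a2] := frequency_lt1 t.2.1.
have /andP[b1 b2] := frequency_lt1 t.2.2.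
rewrite /enorm /interpolant_frequency /=.
move: (frequency t.2.1) (frequency t.2.2) a1 a2 b1 b2 => a b a1 a2 b1 b2.
have a25 : 25 < (6 + a) ^+ 2 by nra.
have a49 : (6 + a) ^+ 2 < 49 by nra.
have b0 : 0 <= b ^+ 2 by exact: sqr_ge0.
have b1' : b ^+ 2 < 1 by nra.
have sqrt_nat (m : nat) : m%:R = Num.sqrt (m%:R ^+ 2) :> R.
  by rewrite sqrtr_sqr normr_nat.
rewrite (sqrt_nat 4%N) (sqrt_nat 8%N).
by rewrite !ltr_sqrt; [apply/andP; split; lra|lra|lra].
Qed.

End fejer_interpolation.

(** * Bounds for the operator norm *)

Section operator_norm.
Local Open Scope complex_scope.
Context {R : realType} {H : completeNormedModType R[i]}.

Lemma opnorm_le (F : H -> H) (M : R) : 0 <= M ->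
  (forall x, `|F x| <= M%:C * `|x|) -> (opnorm F <= M%:E)%E.
Proof.
move=> M0 FM; apply: ge_ereal_sup => _ /= [x x1 <-]; rewrite lee_fin.
have : `|F x| <= M%:C.
  by apply: (le_trans (FM x)); rewrite ler_piMr// lecR.
by rewrite lecE => /andP[].
Qed.

Lemma le_opnorm (F : H -> H) (x : H) : `|x| <= 1 ->
  ((complex.Re `|F x|)%:E <= opnorm F)%E.
Proof. by move=> x1; apply: ereal_sup_ubound; exists x. Qed.

Lemma opnorm_ge0 (F : H -> H) : (0 <= opnorm F)%E.
Proof.
have x0 : `|0 : H| <= 1 by rewrite normr0.
apply: le_trans (le_opnorm F x0); rewrite lee_fin.
by have := normr_ge0 (F 0); rewrite lecE => /andP[].
Qed.

End operator_norm.

Theorem theorem4p2 (R : realType) (w : R -> R) (W : int -> R * R -> R[i])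
    (hw : besov_cutoff w) (hW : besov_kernels w W) :
  ~ exists K : R, 0 < K /\
    forall (H : completeNormedModType R[i]) (dot : {dot H for (@Num.conj R[i])})
      (phi : R * R -> R[i]) (A B Q : {linear H -> H}),
      hilbert_dot dot ->
      besov_function W phi ->
      bounded_op Q ->
      bounded_op A -> finite_rank A -> selfadjoint dot A ->
      bounded_op B -> finite_rank B -> selfadjoint dot B ->
      (opnorm (commutator (funcalc dot phi A B) Q) <=
        K%:E * besov_norm W (regular_distr phi) *
        maxe (opnorm (commutator A Q)) (opnorm (commutator B Q)))%E.
Proof.
move=> [K [K0 hK]].
(* [M] bounds the right-hand side of the supposed estimate for every n at once. *)
pose M := K * besov_bound W * (2 * pi).
(* By the Archimedean property n exceeds M^2; the two successors ensure n > 1. *)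
pose n := (Num.bound (M ^+ 2)).+2.
have n_gt1 : (1 < n)%N by [].
have n_gt0 : (0 < n)%N by [].
have [H [dot [e [hd eo ec]]]] := exists_hilbert_basis R (bool * 'I_n)%type.
have be : orthonormal_basis (dot := dot) e by split.
have bf := fourier_basisP n_gt1 be.
pose phi := @interpolant R n.
have phi_annulus := @interpolant_annulus R n n_gt0.
have phi_le1 := @interpolant_le1 R n n_gt0.
pose f := fourier_basis (n := n) e.
pose A : {linear H -> H} := weighted_map (dot := dot) e e
  (fun p => real_complex R (2 * pi * p.2%:R)).
pose B : {linear H -> H} := weighted_map (dot := dot) f f
  (fun p => real_complex R (2 * pi * (p.2 + p.1)%:R)).
pose Q : {linear H -> H} := weighted_map (dot := dot) e
  (fun p => e (false, p.2)) (fun p => p.1%:R).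
have twopi_ge0 : 0 <= 2 * pi :> R by rewrite mulr_ge0// pi_ge0.
have AQ : (opnorm (commutator A Q) <= (2 * pi)%:E)%E.
  apply: opnorm_le => // x; rewrite (commutator_diagonal_shift be) normr0.
  by rewrite mulr_ge0// ler0c.
have BQ : (opnorm (commutator B Q) <= (2 * pi)%:E)%E.
  apply: opnorm_le => // x; rewrite (commutator_fourier_shift n_gt1 be) normrZ.
  rewrite normrN ger0_norm ?ler0c// ler_wpM2l ?ler0c//.
  exact: (norm_shift hd be).
pose o := Ordinal n_gt0.
have eo1 : `|e (true, o)| <= 1.
  by rewrite -(@expr_le1 _ 2)// hd eo eqxx.
have /= nodes := @interpolant_node R n n_gt0.
have norm_comm := norm_commutator_funcalc n_gt1 hd be nodes
  (erefl : o = 0%N :> nat).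
have := hK H dot phi A B Q hd
  (besov_function_trigpoly hw hW phi_annulus phi_le1)
  (weighted_map_bounded hd be _ _)
  (weighted_map_bounded hd be _ _) (weighted_map_finite_rank _ _ _)
  (diagonal_selfadjoint _ _)
  (weighted_map_bounded hd bf _ _) (weighted_map_finite_rank _ _ _)
  (diagonal_selfadjoint _ _).
apply/negP; rewrite -ltNge; apply: (@le_lt_trans _ _ M%:E).
  have besov_ge0 : (0 <= besov_norm W (regular_distr phi))%E.
    apply: esum_ge0 => k _.
    by rewrite mule_ge0 ?Lnorm_ge0// lee_fin exprz_ge0.
  rewrite /M EFinM; apply: lee_pmul.
  - by rewrite mule_ge0// lee_fin ltW.
  - by rewrite le_max opnorm_ge0.
  - have K0' : (0 <= K%:E)%E by rewrite lee_fin ltW.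
    rewrite EFinM (lee_wpmul2l K0')//.
    exact: (besov_norm_trigpoly hw hW phi_annulus phi_le1).
  - by rewrite ge_max AQ BQ.
(* The operator norm is tested on the unit vector [e (true, o)], where the square of the norm is 2n
   > M^2. *)
apply: lt_le_trans (le_opnorm _ eo1); rewrite lte_fin.
set F := `|_|; have F_real : F = real_complex R (complex.Re F).
  by rewrite RRe_real// normr_real.
have Re_ge0 : 0 <= complex.Re F by rewrite -ler0c -F_real normr_ge0.
have ReF2 : complex.Re F ^+ 2 = n%:R *+ 2.
  have F2 : F ^+ 2 = n%:R *+ 2 by exact: norm_comm.
  apply: complexI; rewrite rmorphXn /= -F_real F2.
  by rewrite rmorphMn /= rmorph_nat.
apply: (le_lt_trans (ler_norm M)).
rewrite -(ltr_pXn2r (n := 2))// ?nnegrE// ReF2 real_normK ?num_real//.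
have M2_lt : M ^+ 2 < n%:R.
  apply: (lt_trans (archi_boundP (sqr_ge0 M))).
  by rewrite ltr_nat.
by apply: (lt_trans M2_lt); rewrite mulr2n ltrDl ltr0n.
Qed.
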